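(* Let $T=(T,m,u)$ be a monad on a monoidal category $(\mathcal M,\otimes,K)$ in which idempotents split. To give $T$ the structure of a weak bimonad is equivalently to give the endofunctor $T$ the structure of an opmonoidal functor $(T,\tau,\tau_0)$ in such a way that the following five identities hold for all objects $X,Y,Z$ of $\mathcal M$: (W1) $m_X\circ T(TX\otimes\tau_0)\circ T(TX\otimes m_K)\circ T\tau_{X,TK}\circ Tu_{X\otimes TK}=(TX\otimes\tau_0)\circ(TX\otimes m_K)\circ\tau_{X,TK}:\ T(X\otimes TK)\to TX$; (W2) $m_X\circ T(\tau_0\otimes TX)\circ T(m_K\otimes TX)\circ T\tau_{TK,X}\circ Tu_{TK\otimes X}=(\tau_0\otimes TX)\circ(m_K\otimes TX)\circ\tau_{TK,X}:\ T(TK\otimes X)\to TX$; (W3) $(TX\otimes m_Y\otimes TZ)\circ(\tau_{X,TY}\otimes TZ)\circ(u_{X\otimes TY}\otimes TZ)\circ(X\otimes\tau_{Y,Z})\circ(X\otimes u_{Y\otimes Z})=(\tau_{X,Y}\otimes TZ)\circ\tau_{X\otimes Y,Z}\circ u_{X\otimes Y\otimes Z}$; (W4) $(TX\otimes m_Y\otimes TZ)\circ(TX\otimes\tau_{TY,Z})\circ(TX\otimes u_{TY\otimes Z})\circ(\tau_{X,Y}\otimes Z)\circ(u_{X\otimes Y}\otimes Z)=(\tau_{X,Y}\otimes TZ)\circ\tau_{X\otimes Y,Z}\circ u_{X\otimes Y\otimes Z}$; (W5) $(m_X\otimes m_Y)\circ\tau_{TX,TY}\circ T\tau_{X,Y}=\tau_{X,Y}\circ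 m_{X\otimes Y}:\ T^2(X\otimes Y)\to TX\otimes TY$.
   Context: Monoidal categories need not be strict, but coherence isomorphisms are suppressed. An object also denotes its identity morphism. An opmonoidal structure on a functor $F:(\mathcal N,\boxtimes,R)\to(\mathcal M,\otimes,K)$ consists of natural $i_{X,Y}:F(X\boxtimes Y)\to FX\otimes FY$ and $i_0:FR\to K$ satisfying the coassociativity and counit laws; dually for a monoidal structure $p_{X,Y}:FX\otimes FY\to F(X\boxtimes Y)$, $p_0:K\to FR$. A functor $F:(\mathcal N,\boxtimes,R)\to(\mathcal M,\otimes,K)$ is separable Frobenius when it is equipped with a monoidal structure $(p,p_0)$ and an opmonoidal structure $(i,i_0)$ such that for all $X,Y,Z$: $(p_{X,Y}\otimes FZ)\circ(FX\otimes i_{Y,Z})=i_{X\boxtimes Y,Z}\circ p_{X,Y\boxtimes Z}$, $(FX\otimes p_{Y,Z})\circ(i_{X,Y}\otimes FZ)=i_{X,Y\boxtimes Z}\circ p_{X\boxtimes Y,Z}$, and $p_{X,Y}\circ i_{X,Y}=\mathrm{id}$. A weak bimonad on $\mathcal M$ is a monad $(T,m,u)$ on $\mathcal M$ equipped with a monoidal structure on the Eilenberg-Moore category $\mathcal M^T$ and a separable Frobenius structure on the forgetful functor $U:\mathcal M^T\to\mathcal M$. The opmonoidal structure on $T$ associated with a weak bimonad is as follows. Write $(\mathcal M^T,\boxtimes,(R,r))$ for the monoidal category of algebras, $(A,a)\boxtimes(B,b)=(A\Box B,a\Box b)$, and $(p,p_0)$, $(i,i_0)$ for the structure of $U$. Then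 $\tau_0=i_0\circ r\circ Tp_0:TK\to K$ and $\tau_{X,Y}=i_{TX,TY}\circ(m_X\Box m_Y)\circ Tp_{TX,TY}\circ T(u_X\otimes u_Y)$, where $TX$ carries the free algebra structure $m_X$. As usual, weak bimonad structures are considered up to isomorphism of the monoidal structures on $\mathcal M^T$ compatible with the structure of $U$ (so different choices of splittings of the same idempotents are identified). *)

(* Defs.v *)
From Stdlib Require Import ProofIrrelevance.

Set Implicit Arguments.
Unset Strict Implicit.
Unset Printing Implicit Defensive.

Declare Scope cat_scope.
Delimit Scope cat_scope with cat.
Open Scope cat_scope.

Record Category := {
  Obj :> Type;
  Hom : Obj -> Obj -> Type;
  idm : forall X, Hom X X;
  comp : forall X Y Z, Hom Y Z -> Hom X Y -> Hom X Z;
  comp_idl : forall X Y (f : Hom X Y), comp (idm Y) f = f;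
  comp_idr : forall X Y (f : Hom X Y), comp f (idm X) = f;
  comp_assoc : forall X Y Z W (h : Hom Z W) (g : Hom Y Z) (f : Hom X Y),
    comp (comp h g) f = comp h (comp g f)
}.

Arguments Hom {_} _ _.
Arguments idm {_} _.
Arguments comp {_ _ _ _} _ _.

Notation "g ∘ f" := (comp g f) (at level 40, left associativity) : cat_scope.

Record Iso (C : Category) (X Y : C) := {
  fwd :> Hom X Y;
  inv : Hom Y X;
  inv_fwd : inv ∘ fwd = idm X;
  fwd_inv : fwd ∘ inv = idm Y
}.

Definition is_iso (C : Category) (X Y : C) (f : Hom X Y) : Prop :=
  exists g : Hom Y X, g ∘ f = idm X /\ f ∘ g = idm Y.

Definition idempotents_split (C : Category) : Prop :=
  forall (X : C) (e : Hom X X), e ∘ e = e ->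
  exists (Y : C) (r : Hom X Y) (s : Hom Y X), r ∘ s = idm Y /\ s ∘ r = e.

Record Functor (C D : Category) := {
  fobj :> C -> D;
  fmap : forall X Y, Hom X Y -> Hom (fobj X) (fobj Y);
  fmap_id : forall X, fmap (idm X) = idm (fobj X);
  fmap_comp : forall X Y Z (g : Hom Y Z) (f : Hom X Y),
    fmap (g ∘ f) = fmap g ∘ fmap f
}.

Arguments fmap {_ _} _ {_ _} _.

Definition id_functor (C : Category) : Functor C C :=
  {| fobj := fun X : C => X;
     fmap := fun X Y (f : Hom X Y) => f;
     fmap_id := fun _ => eq_refl;
     fmap_comp := fun _ _ _ _ _ => eq_refl |}.

Record Monoidal (C : Category) := {
  tens : C -> C -> C;
  tensm : forall X X' Y Y', Hom X X' -> Hom Y Y' ->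
    Hom (tens X Y) (tens X' Y');
  tensm_id : forall X Y, tensm (idm X) (idm Y) = idm (tens X Y);
  tensm_comp : forall X X' X'' Y Y' Y''
      (f' : Hom X' X'') (f : Hom X X') (g' : Hom Y' Y'') (g : Hom Y Y'),
    tensm (f' ∘ f) (g' ∘ g) = tensm f' g' ∘ tensm f g;
  munit : C;
  assoc : forall X Y Z, Iso (tens (tens X Y) Z) (tens X (tens Y Z));
  lunit : forall X, Iso (tens munit X) X;
  runit : forall X, Iso (tens X munit) X;
  assoc_nat : forall X X' Y Y' Z Z'
      (f : Hom X X') (g : Hom Y Y') (h : Hom Z Z'),
    assoc X' Y' Z' ∘ tensm (tensm f g) h = tensm f (tensm g h) ∘ assoc X Y Z;
  lunit_nat : forall X X' (f : Hom X X'),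
    lunit X' ∘ tensm (idm munit) f = f ∘ lunit X;
  runit_nat : forall X X' (f : Hom X X'),
    runit X' ∘ tensm f (idm munit) = f ∘ runit X;
  pentagon : forall X Y Z W,
    assoc X Y (tens Z W) ∘ assoc (tens X Y) Z W
    = tensm (idm X) (assoc Y Z W) ∘ assoc X (tens Y Z) W
      ∘ tensm (assoc X Y Z) (idm W);
  triangle : forall X Y,
    tensm (idm X) (lunit Y) ∘ assoc X munit Y = tensm (runit X) (idm Y)
}.

Arguments tensm {_} _ {_ _ _ _} _ _.

Section FunctorStructures.

Variables (N M : Category) (VN : Monoidal N) (VM : Monoidal M).
Variable F : Functor N M.

Local Notation "X ⊠ Y" := (tens VN X Y) (at level 35, right associativity).
Local Notation "X ⊗ Y" := (tens VM X Y) (at level 35, right associativity).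
Local Notation "f ⊠' g" := (tensm VN f g) (at level 35, right associativity).
Local Notation "f ⊗' g" := (tensm VM f g) (at level 35, right associativity).
Local Notation R := (munit VN).
Local Notation K := (munit VM).

Record MonoidalData := {
  mu : forall X Y, Hom (F X ⊗ F Y) (F (X ⊠ Y));
  mu0 : Hom K (F R)
}.

Record IsMonoidal (p : MonoidalData) : Prop := {
  mu_nat : forall X X' Y Y' (f : Hom X X') (g : Hom Y Y'),
    mu p X' Y' ∘ (fmap F f ⊗' fmap F g) = fmap F (f ⊠' g) ∘ mu p X Y;
  mu_assoc : forall X Y Z,
    fmap F (assoc VN X Y Z) ∘ mu p (X ⊠ Y) Z ∘ (mu p X Y ⊗' idm (F Z))
    = mu p X (Y ⊠ Z) ∘ (idm (F X) ⊗' mu p Y Z)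
      ∘ assoc VM (F X) (F Y) (F Z);
  mu_lunit : forall X,
    fmap F (lunit VN X) ∘ mu p R X ∘ (mu0 p ⊗' idm (F X)) = lunit VM (F X);
  mu_runit : forall X,
    fmap F (runit VN X) ∘ mu p X R ∘ (idm (F X) ⊗' mu0 p) = runit VM (F X)
}.

Record OpmonoidalData := {
  nu : forall X Y, Hom (F (X ⊠ Y)) (F X ⊗ F Y);
  nu0 : Hom (F R) K
}.

Record IsOpmonoidal (i : OpmonoidalData) : Prop := {
  nu_nat : forall X X' Y Y' (f : Hom X X') (g : Hom Y Y'),
    (fmap F f ⊗' fmap F g) ∘ nu i X Y = nu i X' Y' ∘ fmap F (f ⊠' g);
  nu_coassoc : forall X Y Z,
    assoc VM (F X) (F Y) (F Z) ∘ (nu i X Y ⊗' idm (F Z)) ∘ nu i (X ⊠ Y) Z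
    = (idm (F X) ⊗' nu i Y Z) ∘ nu i X (Y ⊠ Z) ∘ fmap F (assoc VN X Y Z);
  nu_lcounit : forall X,
    lunit VM (F X) ∘ (nu0 i ⊗' idm (F X)) ∘ nu i R X = fmap F (lunit VN X);
  nu_rcounit : forall X,
    runit VM (F X) ∘ (idm (F X) ⊗' nu0 i) ∘ nu i X R = fmap F (runit VN X)
}.

Definition opmonoidal_eq (i j : OpmonoidalData) : Prop :=
  (forall X Y, nu i X Y = nu j X Y) /\ nu0 i = nu0 j.

Record SeparableFrobenius := {
  sf_mon : MonoidalData;
  sf_opmon : OpmonoidalData;
  sf_is_mon : IsMonoidal sf_mon;
  sf_is_opmon : IsOpmonoidal sf_opmon;
  sf_frob_l : forall X Y Z,
    (mu sf_mon X Y ⊗' idm (F Z)) ∘ inv (assoc VM (F X) (F Y) (F Z))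
      ∘ (idm (F X) ⊗' nu sf_opmon Y Z)
    = nu sf_opmon (X ⊠ Y) Z ∘ fmap F (inv (assoc VN X Y Z))
      ∘ mu sf_mon X (Y ⊠ Z);
  sf_frob_r : forall X Y Z,
    (idm (F X) ⊗' mu sf_mon Y Z) ∘ assoc VM (F X) (F Y) (F Z)
      ∘ (nu sf_opmon X Y ⊗' idm (F Z))
    = nu sf_opmon X (Y ⊠ Z) ∘ fmap F (assoc VN X Y Z)
      ∘ mu sf_mon (X ⊠ Y) Z;
  sf_sep : forall X Y, mu sf_mon X Y ∘ nu sf_opmon X Y = idm (F (X ⊠ Y))
}.

End FunctorStructures.

Record Monad (M : Category) := {
  mfun :> Functor M M;
  mmul : forall X, Hom (mfun (mfun X)) (mfun X);
  meta : forall X, Hom X (mfun X);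
  mmul_nat : forall X Y (f : Hom X Y),
    mmul Y ∘ fmap mfun (fmap mfun f) = fmap mfun f ∘ mmul X;
  meta_nat : forall X Y (f : Hom X Y), meta Y ∘ f = fmap mfun f ∘ meta X;
  mmul_assoc : forall X, mmul X ∘ fmap mfun (mmul X) = mmul X ∘ mmul (mfun X);
  mmul_etal : forall X, mmul X ∘ meta (mfun X) = idm (mfun X);
  mmul_etar : forall X, mmul X ∘ fmap mfun (meta X) = idm (mfun X)
}.

Section EilenbergMoore.

Variables (M : Category) (T : Monad M).

Record Algebra := {
  carrier : M;
  action : Hom (T carrier) carrier;
  action_unit : action ∘ meta T carrier = idm carrier;
  action_mul : action ∘ mmul T carrier = action ∘ fmap T action
}.

Record AlgHom (A B : Algebra) := {
  ahom : Hom (carrier A) (carrier B);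
  ahom_action : ahom ∘ action A = action B ∘ fmap T ahom
}.

Lemma AlgHom_eq (A B : Algebra) (f g : AlgHom A B) : ahom f = ahom g -> f = g.
Proof.
destruct f as [f hf], g as [g hg]; simpl; intros E; subst g.
f_equal; apply proof_irrelevance.
Qed.

Lemma alg_id_action (A : Algebra) :
  idm (carrier A) ∘ action A = action A ∘ fmap T (idm (carrier A)).
Proof. now rewrite fmap_id, comp_idl, comp_idr. Qed.

Lemma alg_comp_action (A B C : Algebra) (g : AlgHom B C) (f : AlgHom A B) :
  (ahom g ∘ ahom f) ∘ action A = action C ∘ fmap T (ahom g ∘ ahom f).
Proof.
now rewrite fmap_comp, comp_assoc, ahom_action, <- comp_assoc, ahom_action,
  comp_assoc.
Qed.

Definition alg_id (A : Algebra) : AlgHom A A :=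
  {| ahom := idm (carrier A); ahom_action := alg_id_action A |}.

Definition alg_comp (A B C : Algebra) (g : AlgHom B C) (f : AlgHom A B) :
    AlgHom A C :=
  {| ahom := ahom g ∘ ahom f; ahom_action := alg_comp_action g f |}.

Definition EM : Category.
Proof.
refine {| Obj := Algebra; Hom := AlgHom; idm := alg_id; comp := alg_comp |}.
- intros A B f; apply AlgHom_eq, comp_idl.
- intros A B f; apply AlgHom_eq, comp_idr.
- intros A B C D h g f; apply AlgHom_eq, comp_assoc.
Defined.

Definition forgetful : Functor EM M :=
  {| fobj := carrier : EM -> M;
     fmap := fun (A B : EM) (f : Hom A B) => ahom f;
     fmap_id := fun _ => eq_refl;
     fmap_comp := fun _ _ _ _ _ => eq_refl |}.

Definition free_alg (X : M) : EM :=
  {| carrier := T X;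
     action := mmul T X;
     action_unit := mmul_etal T X;
     action_mul := eq_sym (mmul_assoc T X) |}.

End EilenbergMoore.

Section WeakBimonad.

Variables (M : Category) (V : Monoidal M) (T : Monad M).

Local Notation "X ⊗ Y" := (tens V X Y) (at level 35, right associativity).
Local Notation "f ⊗' g" := (tensm V f g) (at level 35, right associativity).
Local Notation K := (munit V).
Local Notation m := (mmul T).
Local Notation u := (meta T).
Local Notation α := (assoc V).
Local Notation "'α⁻' X Y Z" := (inv (assoc V X Y Z))
  (at level 10, X at level 9, Y at level 9, Z at level 9).

Record WeakBimonad := {
  wb_tens : Monoidal (EM T);
  wb_frob : SeparableFrobenius wb_tens V (forgetful T)
}.

(* An isomorphism of the monoidal structures on the Eilenberg-Moore category,
   compatible with the structures of the forgetful functor: the identity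
   functor from the second monoidal category to the first carries a strong
   monoidal structure with components A ⊠ B -> A ⊠' B and R -> R'. *)
Record WeakBimonadIso (B B' : WeakBimonad) := {
  wbi : MonoidalData (wb_tens B') (wb_tens B) (id_functor (EM T));
  wbi_is_monoidal : IsMonoidal wbi;
  wbi_iso : forall P Q : EM T, is_iso (mu wbi P Q);
  wbi_iso0 : is_iso (mu0 wbi);
  wbi_p : forall P Q : EM T,
    ahom (mu wbi P Q) ∘ mu (sf_mon (wb_frob B)) P Q
    = mu (sf_mon (wb_frob B')) P Q;
  wbi_p0 :
    ahom (mu0 wbi) ∘ mu0 (sf_mon (wb_frob B)) = mu0 (sf_mon (wb_frob B'));
  wbi_i : forall P Q : EM T,
    nu (sf_opmon (wb_frob B')) P Q ∘ ahom (mu wbi P Q)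
    = nu (sf_opmon (wb_frob B)) P Q;
  wbi_i0 :
    nu0 (sf_opmon (wb_frob B')) ∘ ahom (mu0 wbi)
    = nu0 (sf_opmon (wb_frob B))
}.

Definition wb_isomorphic (B B' : WeakBimonad) : Prop :=
  inhabited (WeakBimonadIso B B').

Definition associated_opmonoidal (B : WeakBimonad) : OpmonoidalData V V T :=
  let p := sf_mon (wb_frob B) in
  let i := sf_opmon (wb_frob B) in
  {| nu := fun X Y : M =>
       nu i (free_alg T X) (free_alg T Y)
       ∘ action (tens (wb_tens B) (free_alg T X) (free_alg T Y))
       ∘ fmap T (mu p (free_alg T X) (free_alg T Y))
       ∘ fmap T (u X ⊗' u Y);
     nu0 := nu0 i ∘ action (munit (wb_tens B)) ∘ fmap T (mu0 p) |}.

Section Identities.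

Variable t : OpmonoidalData V V T.
Local Notation τ := (nu t).
Local Notation τ0 := (nu0 t).

(* The associators and unitors suppressed in the usual statement of these
   identities are inserted; both sides of W3 and W4 are taken as morphisms
   (X ⊗ Y) ⊗ Z -> (T X ⊗ T Y) ⊗ T Z. *)

Definition W1 : Prop := forall X : M,
  m X ∘ fmap T (runit V (T X)) ∘ fmap T (idm (T X) ⊗' τ0)
    ∘ fmap T (idm (T X) ⊗' m K) ∘ fmap T (τ X (T K))
    ∘ fmap T (u (X ⊗ T K))
  = runit V (T X) ∘ (idm (T X) ⊗' τ0) ∘ (idm (T X) ⊗' m K) ∘ τ X (T K).

Definition W2 : Prop := forall X : M,
  m X ∘ fmap T (lunit V (T X)) ∘ fmap T (τ0 ⊗' idm (T X))
    ∘ fmap T (m K ⊗' idm (T X)) ∘ fmap T (τ (T K) X)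
    ∘ fmap T (u (T K ⊗ X))
  = lunit V (T X) ∘ (τ0 ⊗' idm (T X)) ∘ (m K ⊗' idm (T X)) ∘ τ (T K) X.

Definition W3 : Prop := forall X Y Z : M,
  ((idm (T X) ⊗' m Y) ⊗' idm (T Z)) ∘ (τ X (T Y) ⊗' idm (T Z))
    ∘ (u (X ⊗ T Y) ⊗' idm (T Z)) ∘ α⁻ X (T Y) (T Z)
    ∘ (idm X ⊗' τ Y Z) ∘ (idm X ⊗' u (Y ⊗ Z)) ∘ α X Y Z
  = (τ X Y ⊗' idm (T Z)) ∘ τ (X ⊗ Y) Z ∘ u ((X ⊗ Y) ⊗ Z).

Definition W4 : Prop := forall X Y Z : M,
  α⁻ (T X) (T Y) (T Z) ∘ (idm (T X) ⊗' (m Y ⊗' idm (T Z)))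
    ∘ (idm (T X) ⊗' τ (T Y) Z) ∘ (idm (T X) ⊗' u (T Y ⊗ Z))
    ∘ α (T X) (T Y) Z ∘ (τ X Y ⊗' idm Z) ∘ (u (X ⊗ Y) ⊗' idm Z)
  = (τ X Y ⊗' idm (T Z)) ∘ τ (X ⊗ Y) Z ∘ u ((X ⊗ Y) ⊗ Z).

Definition W5 : Prop := forall X Y : M,
  (m X ⊗' m Y) ∘ τ (T X) (T Y) ∘ fmap T (τ X Y) = τ X Y ∘ m (X ⊗ Y).

End Identities.

End WeakBimonad.

(* Main.v *)
(** Given [τ] and algebras [(A,a)], [(B,b)], the map [φ = (a ⊗ b) ∘ τ] is an
    associative but not unital action of [T] on [A ⊗ B] (W5), so [E = φ ∘ u] is
    idempotent and [T] acts unitally on its splitting [A □ B]; the splitting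
    maps [p] and [i] are the structure of the forgetful functor. Both triple products
    split the same idempotent of [A ⊗ B ⊗ C], which gives associativity, and
    W3-W4 express that idempotent as a product of binary ones, which gives the
    Frobenius laws. The unit algebra splits an idempotent of [TK] built from
    [τ0 ∘ m]; W1-W2 provide the unit constraints.

    Conversely a weak bimonad yields [φ = i ∘ (a □ b) ∘ Tp], natural in algebra
    maps, with [φ ∘ u = i ∘ p] and [τ = φ ∘ T(u ⊗ u)]. As [φ = (a ⊗ b) ∘ τ]
    again, [τ] determines the idempotents [i ∘ p] and the actions on their splittings,
    hence the weak bimonad up to [p' ∘ i : A □ B → A □' B]. *)

From Stdlib Require Import ssreflect ClassicalEpsilon.
Require Import Defs.

Set Implicit Arguments.
Unset Strict Implicit.
Unset Printing Implicit Defensive.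

(** * Rewriting inside composites *)

Section Composition.

Variable C : Category.

Lemma comp_assoc_l (X Y Z W : C) (h : Hom Z W) (g : Hom Y Z) (f : Hom X Y) :
  h ∘ (g ∘ f) = h ∘ g ∘ f.
Proof. by rewrite comp_assoc. Qed.

Lemma post2 (X Y Z : C) (g : Hom Y Z) (f : Hom X Y) h :
  g ∘ f = h -> forall W (k : Hom Z W), k ∘ g ∘ f = k ∘ h.
Proof. by move=> <- W k; rewrite comp_assoc. Qed.

Lemma post3 (X Y Z Z' : C) (g' : Hom Z Z') (g : Hom Y Z) (f : Hom X Y) h :
  g' ∘ g ∘ f = h -> forall W (k : Hom Z' W), k ∘ g' ∘ g ∘ f = k ∘ h.
Proof. by move=> <- W k; rewrite !comp_assoc. Qed.

Lemma post4 (X Y Z Z' Z'' : C) (g'' : Hom Z' Z'') (g' : Hom Z Z')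
    (g : Hom Y Z) (f : Hom X Y) h :
  g'' ∘ g' ∘ g ∘ f = h ->
  forall W (k : Hom Z'' W), k ∘ g'' ∘ g' ∘ g ∘ f = k ∘ h.
Proof. by move=> <- W k; rewrite !comp_assoc. Qed.

End Composition.

(* [crw H] rewrites with an equation [H] between composites anywhere inside a
   composite bracketed to the left, and brackets the result to the left. *)
Ltac rw_post H :=
  first [rewrite (post2 H) | rewrite (post3 H) | rewrite (post4 H)].
Ltac bracket_left := repeat
  match goal with |- context [comp ?h (comp ?g ?f)] =>
    rewrite (comp_assoc_l h g f) end.
Ltac rw_post_with_holes H n :=
  first [ rw_post H
        | match n with
          | S ?n' => rw_post_with_holes uconstr:(H _) n'
          end ].
Tactic Notation "crw" uconstr(H) :=
  bracket_left; first [ rewrite H | rw_post_with_holes H 16 ]; bracket_left.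

Lemma fmap_comp_r (C D : Category) (F : Functor C D) X Y Z (g : Hom Y Z)
    (f : Hom X Y) :
  fmap F g ∘ fmap F f = fmap F (g ∘ f).
Proof. by rewrite fmap_comp. Qed.

Lemma iso_mono (C : Category) (X Y : C) (g : Iso X Y) Z (f f' : Hom Z X) :
  g ∘ f = g ∘ f' -> f = f'.
Proof.
by move=> E; rewrite -(comp_idl f) -(comp_idl f') -(inv_fwd g) !comp_assoc E.
Qed.

Lemma iso_epi (C : Category) (X Y : C) (g : Iso X Y) Z (f f' : Hom Y Z) :
  f ∘ g = f' ∘ g -> f = f'.
Proof.
by move=> E; rewrite -(comp_idr f) -(comp_idr f') -(fwd_inv g) -!comp_assoc E.
Qed.

(** * Monoidal coherence *)

Section Coherence.

Variables (M : Category) (V : Monoidal M).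

Local Notation "X ⊗ Y" := (tens V X Y) (at level 35, right associativity).
Local Notation "f ⊗' g" := (tensm V f g) (at level 35, right associativity).
Local Notation K := (munit V).
Local Notation α := (assoc V).

Lemma tensm_comp_r X X' X'' Y Y' Y''
    (f' : Hom X' X'') (f : Hom X X') (g' : Hom Y' Y'') (g : Hom Y Y') :
  (f' ⊗' g') ∘ (f ⊗' g) = (f' ∘ f) ⊗' (g' ∘ g).
Proof. by rewrite tensm_comp. Qed.

Lemma tensm_idl_comp X Y Y' Y'' (g' : Hom Y' Y'') (g : Hom Y Y') :
  idm X ⊗' (g' ∘ g) = (idm X ⊗' g') ∘ (idm X ⊗' g).
Proof. by rewrite tensm_comp_r comp_idl. Qed.

Lemma tensm_idr_comp X X' X'' Y (f' : Hom X' X'') (f : Hom X X') :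
  (f' ∘ f) ⊗' idm Y = (f' ⊗' idm Y) ∘ (f ⊗' idm Y).
Proof. by rewrite tensm_comp_r comp_idl. Qed.

Lemma tensm_exchange X X' Y Y' (f : Hom X X') (g : Hom Y Y') :
  (f ⊗' idm Y') ∘ (idm X ⊗' g) = (idm X' ⊗' g) ∘ (f ⊗' idm Y).
Proof. by rewrite !tensm_comp_r !comp_idl !comp_idr. Qed.

Lemma assoc_inv_nat X X' Y Y' Z Z'
    (f : Hom X X') (g : Hom Y Y') (h : Hom Z Z') :
  inv (α X' Y' Z') ∘ (f ⊗' (g ⊗' h)) = ((f ⊗' g) ⊗' h) ∘ inv (α X Y Z).
Proof.
apply: (@iso_mono _ _ _ (α X' Y' Z')).
rewrite -!comp_assoc assoc_nat fwd_inv comp_idl.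
by rewrite comp_assoc fwd_inv comp_idr.
Qed.

Lemma lunit_inv_nat X X' (f : Hom X X') :
  inv (lunit V X') ∘ f = (idm K ⊗' f) ∘ inv (lunit V X).
Proof.
apply: (@iso_mono _ _ _ (lunit V X')).
rewrite -!comp_assoc lunit_nat fwd_inv comp_idl.
by rewrite comp_assoc fwd_inv comp_idr.
Qed.

Lemma runit_inv_nat X X' (f : Hom X X') :
  inv (runit V X') ∘ f = (f ⊗' idm K) ∘ inv (runit V X).
Proof.
apply: (@iso_mono _ _ _ (runit V X')).
rewrite -!comp_assoc runit_nat fwd_inv comp_idl.
by rewrite comp_assoc fwd_inv comp_idr.
Qed.

Lemma tens_unit_l_faithful X Y (f g : Hom X Y) :
  idm K ⊗' f = idm K ⊗' g -> f = g.
Proof.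
by move=> E; apply: (@iso_epi _ _ _ (lunit V X)); rewrite -!lunit_nat E.
Qed.

Lemma tens_unit_r_faithful X Y (f g : Hom X Y) :
  f ⊗' idm K = g ⊗' idm K -> f = g.
Proof.
by move=> E; apply: (@iso_epi _ _ _ (runit V X)); rewrite -!runit_nat E.
Qed.

(** Kelly's argument: tensoring with [K] on the left is faithful, and after precomposing with two
    associators the pentagon and the triangle reduce the claim to naturality of [α]. *)
Lemma lunit_tens X Y : lunit V (X ⊗ Y) ∘ α K X Y = lunit V X ⊗' idm Y.
Proof.
apply: tens_unit_l_faithful.
apply: (@iso_epi _ _ _ (α K (K ⊗ X) Y)).
have epi : forall Z (f f' : Hom ((K ⊗ K ⊗ X) ⊗ Y) Z),
    f ∘ (α K K X ⊗' idm Y) = f' ∘ (α K K X ⊗' idm Y) -> f = f'.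
  move=> Z f f' E; rewrite -(comp_idr f) -(comp_idr f') -tensm_id.
  rewrite -(fwd_inv (α K K X)) -{1 2}(comp_idl (idm Y)) tensm_comp.
  by rewrite -!comp_assoc E.
apply: epi.
have -> : idm K ⊗' (lunit V (X ⊗ Y) ∘ α K X Y)
    = (idm K ⊗' lunit V (X ⊗ Y)) ∘ (idm K ⊗' α K X Y).
  by rewrite tensm_comp_r comp_idl.
rewrite !comp_assoc -(comp_assoc (idm K ⊗' α K X Y)) -pentagon.
rewrite -!comp_assoc triangle -assoc_nat comp_assoc tensm_comp_r.
by rewrite triangle comp_idl -tensm_id assoc_nat.
Qed.

(** Both sides tensored with [K] factor through [α K K K], by [lunit_tens] and by the triangle. The
    remaining factors agree because naturality of the left unitor at itself can be cancelled. *)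
Lemma lunit_unit : fwd (lunit V K) = runit V K.
Proof.
apply: tens_unit_r_faithful.
rewrite -triangle -lunit_tens; congr (_ ∘ _).
by apply: (@iso_mono _ _ _ (lunit V K)); rewrite lunit_nat.
Qed.

End Coherence.

(** * Splittings of idempotents *)

Section Splittings.

Variable C : Category.

Record Splitting (X : C) (e : Hom X X) := {
  spl_obj : C;
  spl_ret : Hom X spl_obj;
  spl_sec : Hom spl_obj X;
  spl_ret_sec : spl_ret ∘ spl_sec = idm spl_obj;
  spl_sec_ret : spl_sec ∘ spl_ret = e
}.

(** The tensor product on algebras must be a function, so a splitting of each idempotent has to be
    chosen from a mere existence statement. *)
Definition choose_splitting (split : idempotents_split C) (X : C)
    (e : Hom X X) (He : e ∘ e = e) : Splitting e.
Proof.
refine (proj1_sig (constructive_indefinite_description (fun _ => True) _)).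
case: (split X e He) => Y [r [s [rs sr]]].
by exists (Build_Splitting rs sr).
Qed.

Variables (X : C) (e : Hom X X) (S : Splitting e).

Lemma spl_idem_sec : e ∘ spl_sec S = spl_sec S.
Proof.
have /= <- := f_equal (fun x => x ∘ spl_sec S) (spl_sec_ret S).
by rewrite comp_assoc spl_ret_sec comp_idr.
Qed.

Lemma spl_ret_idem : spl_ret S ∘ e = spl_ret S.
Proof.
have /= <- := f_equal (comp (spl_ret S)) (spl_sec_ret S).
by rewrite -comp_assoc spl_ret_sec comp_idl.
Qed.

Lemma spl_sec_mono Y (f g : Hom Y (spl_obj S)) :
  spl_sec S ∘ f = spl_sec S ∘ g -> f = g.
Proof.
move=> E; rewrite -(comp_idl f) -(comp_idl g) -(spl_ret_sec S).
by rewrite !comp_assoc E.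
Qed.

End Splittings.

(** * Isomorphisms of algebras *)

Section AlgebraIso.

Variables (M : Category) (T : Monad M) (A B : Algebra T).
Variables (f : AlgHom A B) (g : Hom (carrier B) (carrier A)).
Hypotheses (gf : g ∘ ahom f = idm _) (fg : ahom f ∘ g = idm _).

(** The forgetful functor reflects isomorphisms, so coherence constraints need only be inverted in
    [M]. *)
Lemma alg_inv_action : g ∘ action B = action A ∘ fmap T g.
Proof.
rewrite -(comp_idr (g ∘ _)) -fmap_id -fg fmap_comp; bracket_left.
by crw (eq_sym (ahom_action f)); rewrite gf comp_idl.
Qed.

Definition alg_iso : @Iso (EM T) A B :=
  @Build_Iso (EM T) A B f (Build_AlgHom alg_inv_action)
    (AlgHom_eq (gf : ahom (alg_comp (Build_AlgHom alg_inv_action) f)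
                     = ahom (alg_id A)))
    (AlgHom_eq (fg : ahom (alg_comp f (Build_AlgHom alg_inv_action))
                     = ahom (alg_id B))).

End AlgebraIso.

(** * The tensor product of algebras *)

Section OpmonoidalMonad.

Variables (M : Category) (V : Monoidal M) (T : Monad M).
Variable t : OpmonoidalData V V T.
Hypothesis Ht : IsOpmonoidal t.

Local Notation "X ⊗ Y" := (tens V X Y) (at level 35, right associativity).
Local Notation "f ⊗' g" := (tensm V f g) (at level 35, right associativity).
Local Notation m := (mmul T).
Local Notation u := (meta T).
Local Notation α := (assoc V).
Local Notation τ := (nu t).
Local Notation "'TT' f" := (fmap T f) (at level 10, f at level 9).

Implicit Types A B C D : Algebra T.

(* Locked because [rewrite] would otherwise see through the definition when
   looking for composites. *)
Definition tens_action A B :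
    Hom (T (carrier A ⊗ carrier B)) (carrier A ⊗ carrier B) :=
  locked ((action A ⊗' action B) ∘ τ (carrier A) (carrier B)).

Definition tens_idem A B :
    Hom (carrier A ⊗ carrier B) (carrier A ⊗ carrier B) :=
  locked (tens_action A B ∘ u (carrier A ⊗ carrier B)).

Local Notation φ := tens_action.
Local Notation E := tens_idem.

Lemma tens_actionE A B :
  φ A B = (action A ⊗' action B) ∘ τ (carrier A) (carrier B).
Proof. by rewrite /tens_action -lock. Qed.

Lemma tens_idemE A B : E A B = φ A B ∘ u (carrier A ⊗ carrier B).
Proof. by rewrite /tens_idem -lock. Qed.

Lemma tens_action_nat A A' B B' (f : AlgHom A A') (g : AlgHom B B') :
  φ A' B' ∘ TT (ahom f ⊗' ahom g) = (ahom f ⊗' ahom g) ∘ φ A B.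
Proof.
rewrite !tens_actionE comp_assoc -(nu_nat Ht); bracket_left.
by rewrite !tensm_comp_r !ahom_action.
Qed.

Lemma tens_idem_nat A A' B B' (f : AlgHom A A') (g : AlgHom B B') :
  E A' B' ∘ (ahom f ⊗' ahom g) = (ahom f ⊗' ahom g) ∘ E A B.
Proof.
rewrite !tens_idemE comp_assoc meta_nat; bracket_left.
by rewrite tens_action_nat.
Qed.

Hypothesis HW5 : W5 t.

(** Naturality of [τ] moves the inner actions out, the action laws turn them into multiplications,
    and W5 absorbs these. *)
Lemma tens_action_assoc A B :
  φ A B ∘ TT (φ A B) = φ A B ∘ m (carrier A ⊗ carrier B).
Proof.
rewrite !tens_actionE fmap_comp; bracket_left.
rewrite (comp_assoc (_ ⊗' _) (τ _ _)) -(nu_nat Ht); bracket_left.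
by rewrite tensm_comp_r -!action_mul tensm_comp; crw HW5.
Qed.

(** Associativity of [φ] and the two unit laws of the monad let [φ] absorb [E] on either side;
    idempotence of [E] follows. *)
Lemma tens_action_idem A B : φ A B ∘ TT (E A B) = φ A B.
Proof.
rewrite tens_idemE fmap_comp; bracket_left; rewrite tens_action_assoc.
by crw mmul_etar; rewrite comp_idr.
Qed.

Lemma tens_idem_action A B : E A B ∘ φ A B = φ A B.
Proof.
rewrite !tens_idemE comp_assoc meta_nat; bracket_left.
rewrite tens_action_assoc.
by crw mmul_etal; rewrite comp_idr.
Qed.

Lemma tens_idem_idem A B : E A B ∘ E A B = E A B.
Proof.
by rewrite {2}tens_idemE; bracket_left; rewrite tens_idem_action -tens_idemE.
Qed.

(** The formula of [tens_action] with the nonunital action [φ A B] in place of an algebra structure,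
    so that triple products can be studied before splitting. *)
Definition tens_action3_l A B C :
    Hom (T ((carrier A ⊗ carrier B) ⊗ carrier C))
        ((carrier A ⊗ carrier B) ⊗ carrier C) :=
  locked ((φ A B ⊗' action C) ∘ τ (carrier A ⊗ carrier B) (carrier C)).

Definition tens_action3_r A B C :
    Hom (T (carrier A ⊗ carrier B ⊗ carrier C))
        (carrier A ⊗ carrier B ⊗ carrier C) :=
  locked ((action A ⊗' φ B C) ∘ τ (carrier A) (carrier B ⊗ carrier C)).

Local Notation φl := tens_action3_l.
Local Notation φr := tens_action3_r.

Lemma tens_action3_lE A B C :
  φl A B C
  = (φ A B ⊗' action C) ∘ τ (carrier A ⊗ carrier B) (carrier C).
Proof. by rewrite /tens_action3_l -lock. Qed.

Lemma tens_action3_rE A B C :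
  φr A B C
  = (action A ⊗' φ B C) ∘ τ (carrier A) (carrier B ⊗ carrier C).
Proof. by rewrite /tens_action3_r -lock. Qed.

Lemma assoc_tens_action3 A B C :
  α (carrier A) (carrier B) (carrier C) ∘ φl A B C
  = φr A B C ∘ TT (α (carrier A) (carrier B) (carrier C)).
Proof.
rewrite tens_action3_lE tens_action3_rE !tens_actionE.
have -> : ((action A ⊗' action B) ∘ τ (carrier A) (carrier B)) ⊗' action C
   = ((action A ⊗' action B) ⊗' action C) ∘ (τ _ _ ⊗' idm _).
  by rewrite tensm_comp_r comp_idr.
have -> : action A ⊗' ((action B ⊗' action C) ∘ τ (carrier B) (carrier C))
   = (action A ⊗' (action B ⊗' action C)) ∘ (idm _ ⊗' τ _ _).
  by rewrite tensm_comp_r comp_idr.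
bracket_left; rewrite assoc_nat; crw (nu_coassoc Ht); done.
Qed.

Lemma tens_action3_l_idem A B C :
  φl A B C ∘ TT (E A B ⊗' idm (carrier C)) = φl A B C.
Proof.
rewrite tens_action3_lE comp_assoc -(nu_nat Ht); bracket_left.
by rewrite tensm_comp_r tens_action_idem fmap_id comp_idr.
Qed.

Lemma tens_action3_r_idem A B C :
  φr A B C ∘ TT (idm (carrier A) ⊗' E B C) = φr A B C.
Proof.
rewrite tens_action3_rE comp_assoc -(nu_nat Ht); bracket_left.
by rewrite tensm_comp_r tens_action_idem fmap_id comp_idr.
Qed.

(* W3 and W4 say that [E ⊗ C] and [A ⊗ E] commute with product this
   idempotent, through which both iterated tensor products of algebras split. *)
Definition tens_idem3 A B C := locked (φl A B C ∘ u _).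

Lemma tens_idem3E A B C : tens_idem3 A B C = φl A B C ∘ u _.
Proof. by rewrite /tens_idem3 -lock. Qed.

(** This is W3 at the three carriers, followed by the three actions. They turn the right side into
    [φl ∘ u] and the left side into a product of two binary idempotents. *)
Lemma tens_idem3_W3 : W3 t -> forall A B C,
  (E A B ⊗' idm (carrier C)) ∘ inv (α (carrier A) (carrier B) (carrier C))
    ∘ (idm (carrier A) ⊗' E B C) ∘ α (carrier A) (carrier B) (carrier C)
  = tens_idem3 A B C.
Proof.
move=> H A B C; set a := carrier A; set b := carrier B; set c := carrier C.
have /(f_equal (comp ((action A ⊗' action B) ⊗' action C))) := H a b c.
bracket_left; rewrite !tensm_comp_r ?comp_idr.
rewrite -tens_actionE -tens_action3_lE -tens_idem3E => <-.
(* The action of [B] after [m b] equals the action after its own image under [T]; the latter slides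
   back through [τ] and [u]. *)
have -> : (action A ⊗' (action B ∘ m b)) ∘ τ a (T b) ∘ u (a ⊗ T b)
   = E A B ∘ (idm a ⊗' action B).
  rewrite tens_idemE (tens_actionE A B) action_mul.
  rewrite -{1}(comp_idr (action A)) -{1}(fmap_id T).
  rewrite tensm_comp; crw (nu_nat Ht); rewrite comp_assoc -meta_nat.
  by bracket_left.
have -> : (E A B ∘ (idm a ⊗' action B)) ⊗' action C
  = (E A B ⊗' idm c) ∘ ((idm a ⊗' action B) ⊗' action C).
  by rewrite tensm_comp_r comp_idl.
crw (eq_sym (assoc_inv_nat _ _ _ _)).
crw tensm_comp_r; crw tensm_comp_r.
by rewrite !comp_idl (tens_idemE B C) (tens_actionE B C); bracket_left.
Qed.

Lemma tens_idem3_W4 : W4 t -> forall A B C,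
  inv (α (carrier A) (carrier B) (carrier C))
    ∘ (idm (carrier A) ⊗' E B C) ∘ α (carrier A) (carrier B) (carrier C)
    ∘ (E A B ⊗' idm (carrier C))
  = tens_idem3 A B C.
Proof.
move=> H A B C; set a := carrier A; set b := carrier B; set c := carrier C.
have /(f_equal (comp ((action A ⊗' action B) ⊗' action C))) := H a b c.
bracket_left; rewrite !tensm_comp_r ?comp_idr.
rewrite -tens_actionE -tens_action3_lE -tens_idem3E => <-.
rewrite -assoc_inv_nat.
do 5 crw tensm_comp_r; rewrite !comp_idr.
have -> : ((action B ∘ m b) ⊗' action C) ∘ τ (T b) c ∘ u (T b ⊗ c)
   = E B C ∘ (action B ⊗' idm c).
  rewrite tens_idemE (tens_actionE B C) action_mul.
  rewrite -{1}(comp_idr (action C)) -{1}(fmap_id T).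
  rewrite tensm_comp; crw (nu_nat Ht); rewrite comp_assoc -meta_nat.
  by bracket_left.
have -> : action A ⊗' (E B C ∘ (action B ⊗' idm c))
  = (idm a ⊗' E B C) ∘ (action A ⊗' (action B ⊗' idm c)).
  by rewrite tensm_comp_r comp_idl.
crw (eq_sym (assoc_nat _ _ _ _)); crw tensm_comp_r.
by rewrite !comp_idl (tens_idemE A B) (tens_actionE A B); bracket_left.
Qed.

(** * The box product of algebras *)

Hypothesis split : idempotents_split M.

Definition box_splitting A B : Splitting (E A B) :=
  choose_splitting split (tens_idem_idem A B).

Local Notation pp A B := (spl_ret (box_splitting A B)).
Local Notation ii A B := (spl_sec (box_splitting A B)).

Lemma box_action_unit A B :
  pp A B ∘ φ A B ∘ TT (ii A B) ∘ u _ = idm _.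
Proof.
rewrite comp_assoc -meta_nat; bracket_left.
by rewrite (comp_assoc _ (φ A B)) -tens_idemE spl_ret_idem spl_ret_sec.
Qed.

Lemma box_action_mul A B :
  pp A B ∘ φ A B ∘ TT (ii A B) ∘ m _
  = pp A B ∘ φ A B ∘ TT (ii A B) ∘ TT (pp A B ∘ φ A B ∘ TT (ii A B)).
Proof.
rewrite comp_assoc -mmul_nat !fmap_comp; bracket_left.
crw (fmap_comp_r T (ii A B) (pp A B)).
rewrite spl_sec_ret; crw tens_action_idem.
by crw (tens_action_assoc A B).
Qed.

(** The carrier is the chosen splitting object and the action is [pp ∘ φ ∘ T ii]; both are inferred
    from the two laws. *)
Definition box A B : Algebra T :=
  {| action_unit := box_action_unit A B; action_mul := box_action_mul A B |}.

Lemma box_ret_action A B : action (box A B) ∘ TT (pp A B) = pp A B ∘ φ A B.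
Proof.
rewrite /= comp_assoc fmap_comp_r spl_sec_ret.
by crw tens_action_idem.
Qed.

Lemma box_sec_action A B : ii A B ∘ action (box A B) = φ A B ∘ TT (ii A B).
Proof. by rewrite /=; bracket_left; rewrite spl_sec_ret tens_idem_action. Qed.

Lemma boxm_action A A' B B' (f : AlgHom A A') (g : AlgHom B B') :
  pp A' B' ∘ (ahom f ⊗' ahom g) ∘ ii A B ∘ action (box A B)
  = action (box A' B') ∘ TT (pp A' B' ∘ (ahom f ⊗' ahom g) ∘ ii A B).
Proof.
crw box_sec_action; crw (eq_sym (tens_action_nat f g)).
by rewrite !fmap_comp; bracket_left; rewrite box_ret_action.
Qed.

Definition boxm A A' B B' (f : AlgHom A A') (g : AlgHom B B') :
    AlgHom (box A B) (box A' B') :=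
  @Build_AlgHom _ _ (box A B) (box A' B') _ (boxm_action f g).

Lemma box_sec_nat A A' B B' (f : AlgHom A A') (g : AlgHom B B') :
  ii A' B' ∘ ahom (boxm f g) = (ahom f ⊗' ahom g) ∘ ii A B.
Proof.
rewrite /=; bracket_left; rewrite spl_sec_ret tens_idem_nat.
by rewrite comp_assoc spl_idem_sec.
Qed.

Lemma box_ret_nat A A' B B' (f : AlgHom A A') (g : AlgHom B B') :
  ahom (boxm f g) ∘ pp A B = pp A' B' ∘ (ahom f ⊗' ahom g).
Proof.
rewrite /= comp_assoc spl_sec_ret.
by rewrite comp_assoc -tens_idem_nat; bracket_left; rewrite spl_ret_idem.
Qed.

Section BoxIso.

Variables (A B D : Algebra T).
Variables (c : Hom (carrier A ⊗ carrier B) (carrier D)).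
Variables (d : Hom (carrier D) (carrier A ⊗ carrier B)).
Hypothesis c_action : action D ∘ TT (c ∘ E A B) = c ∘ φ A B.
Hypotheses (cd : c ∘ E A B ∘ d = idm _) (dc : E A B ∘ d ∘ c ∘ E A B = E A B).

Lemma box_iso_action :
  c ∘ ii A B ∘ action (box A B) = action D ∘ TT (c ∘ ii A B).
Proof.
crw box_sec_action; rewrite -c_action; crw fmap_comp_r.
by crw spl_idem_sec.
Qed.

Lemma box_iso_inv_fwd : pp A B ∘ d ∘ (c ∘ ii A B) = idm _.
Proof.
have /(f_equal (fun x => pp A B ∘ x ∘ ii A B)) := dc.
bracket_left; rewrite spl_ret_idem; crw spl_idem_sec => ->.
by rewrite spl_ret_sec.
Qed.

Lemma box_iso_fwd_inv : c ∘ ii A B ∘ (pp A B ∘ d) = idm _.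
Proof. by crw spl_sec_ret. Qed.

(** The hypotheses speak of [c] and [d] up to [E] only, so a constraint can be verified on [A ⊗ B]
    before splitting. The unit constraints are built this way. *)
Definition box_iso : @Iso (EM T) (box A B) D :=
  @alg_iso _ _ (box A B) D (@Build_AlgHom _ _ (box A B) D _ box_iso_action) _
    box_iso_inv_fwd box_iso_fwd_inv.

End BoxIso.

(** * Triple products and the associativity constraint *)

Lemma tens_action_box_ret_l A B C :
  φ (box A B) C ∘ TT (pp A B ⊗' idm (carrier C))
  = (pp A B ⊗' idm (carrier C)) ∘ φl A B C.
Proof.
rewrite (tens_actionE (box A B) C) comp_assoc -(nu_nat Ht); bracket_left.
rewrite tens_action3_lE; bracket_left.
by rewrite !tensm_comp_r box_ret_action fmap_id comp_idl comp_idr.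
Qed.

Lemma tens_action_box_sec_l A B C :
  (ii A B ⊗' idm (carrier C)) ∘ φ (box A B) C
  = φl A B C ∘ TT (ii A B ⊗' idm (carrier C)).
Proof.
rewrite tens_action3_lE comp_assoc -(nu_nat Ht); bracket_left.
rewrite (tens_actionE (box A B) C); bracket_left.
by rewrite !tensm_comp_r box_sec_action fmap_id comp_idl comp_idr.
Qed.

Lemma tens_action_box_ret_r A B C :
  φ A (box B C) ∘ TT (idm (carrier A) ⊗' pp B C)
  = (idm (carrier A) ⊗' pp B C) ∘ φr A B C.
Proof.
rewrite (tens_actionE A (box B C)) comp_assoc -(nu_nat Ht); bracket_left.
rewrite tens_action3_rE; bracket_left.
by rewrite !tensm_comp_r box_ret_action fmap_id comp_idl comp_idr.
Qed.

Lemma tens_action_box_sec_r A B C :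
  (idm (carrier A) ⊗' ii B C) ∘ φ A (box B C)
  = φr A B C ∘ TT (idm (carrier A) ⊗' ii B C).
Proof.
rewrite tens_action3_rE comp_assoc -(nu_nat Ht); bracket_left.
rewrite (tens_actionE A (box B C)); bracket_left.
by rewrite !tensm_comp_r box_sec_action fmap_id comp_idl comp_idr.
Qed.

Definition ret3_l A B C := pp (box A B) C ∘ (pp A B ⊗' idm (carrier C)).
Definition sec3_l A B C := (ii A B ⊗' idm (carrier C)) ∘ ii (box A B) C.
Definition ret3_r A B C := pp A (box B C) ∘ (idm (carrier A) ⊗' pp B C).
Definition sec3_r A B C := (idm (carrier A) ⊗' ii B C) ∘ ii A (box B C).

(** The outer idempotent is [φ ∘ u]. Moving the inner section and retraction through it makes them
    meet as [E A B] under [T], which [φl] absorbs. *)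
Lemma sec_ret3_l A B C :
  sec3_l A B C ∘ ret3_l A B C = tens_idem3 A B C.
Proof.
rewrite /sec3_l /ret3_l; bracket_left; crw spl_sec_ret.
rewrite (tens_idemE (box A B) C); bracket_left; rewrite tens_action_box_sec_l.
rewrite comp_assoc meta_nat; bracket_left.
crw fmap_comp_r; rewrite tensm_comp_r spl_sec_ret comp_idl.
by rewrite tens_action3_l_idem tens_idem3E.
Qed.

Lemma sec_ret3_r A B C :
  sec3_r A B C ∘ ret3_r A B C = φr A B C ∘ u _.
Proof.
rewrite /sec3_r /ret3_r; bracket_left; crw spl_sec_ret.
rewrite (tens_idemE A (box B C)); bracket_left; rewrite tens_action_box_sec_r.
rewrite comp_assoc meta_nat; bracket_left.
crw fmap_comp_r; rewrite tensm_comp_r spl_sec_ret comp_idl.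
by rewrite tens_action3_r_idem.
Qed.

Lemma ret_sec3_l A B C : ret3_l A B C ∘ sec3_l A B C = idm _.
Proof.
rewrite /sec3_l /ret3_l; crw tensm_comp_r.
by rewrite spl_ret_sec comp_idl tensm_id comp_idr spl_ret_sec.
Qed.

Lemma ret_sec3_r A B C : ret3_r A B C ∘ sec3_r A B C = idm _.
Proof.
rewrite /sec3_r /ret3_r; crw tensm_comp_r.
by rewrite spl_ret_sec comp_idl tensm_id comp_idr spl_ret_sec.
Qed.

Lemma sec3_l_action A B C :
  sec3_l A B C ∘ action (box (box A B) C) = φl A B C ∘ TT (sec3_l A B C).
Proof.
rewrite /sec3_l fmap_comp comp_assoc box_sec_action.
by crw tens_action_box_sec_l; bracket_left.
Qed.

Lemma ret3_r_action A B C :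
  action (box A (box B C)) ∘ TT (ret3_r A B C) = ret3_r A B C ∘ φr A B C.
Proof.
rewrite /ret3_r fmap_comp -comp_assoc box_ret_action.
by crw tens_action_box_ret_r; bracket_left.
Qed.

Local Notation α' A B C := (α (carrier A) (carrier B) (carrier C)).

Lemma assoc_inv_tens_action3 A B C :
  inv (α' A B C) ∘ φr A B C = φl A B C ∘ TT (inv (α' A B C)).
Proof.
apply: (@iso_mono _ _ _ (α' A B C)).
rewrite -!comp_assoc assoc_tens_action3 fwd_inv comp_idl.
by rewrite comp_assoc fmap_comp_r fwd_inv fmap_id comp_idr.
Qed.

Lemma box_assoc_action A B C :
  ret3_r A B C ∘ α' A B C ∘ sec3_l A B C ∘ action (box (box A B) C)
  = action (box A (box B C)) ∘ TT (ret3_r A B C ∘ α' A B C ∘ sec3_l A B C).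
Proof.
crw sec3_l_action; crw assoc_tens_action3.
by rewrite -ret3_r_action !fmap_comp; bracket_left.
Qed.

(** Since [α] carries the idempotent split by the left bracketing to the one split by the right
    bracketing, compressing [α] and its inverse to the splittings gives mutually inverse maps. *)
Lemma assoc_tens_idem3 A B C :
  sec3_r A B C ∘ ret3_r A B C ∘ α' A B C = α' A B C ∘ tens_idem3 A B C.
Proof.
rewrite sec_ret3_r tens_idem3E; bracket_left.
by rewrite assoc_tens_action3 comp_assoc meta_nat; bracket_left.
Qed.

Lemma sec3_r_assoc A B C :
  sec3_r A B C ∘ (ret3_r A B C ∘ α' A B C ∘ sec3_l A B C)
  = α' A B C ∘ sec3_l A B C.
Proof.
bracket_left; rewrite assoc_tens_idem3 -sec_ret3_l.
by crw ret_sec3_l; rewrite comp_idr.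
Qed.

Lemma ret3_l_assoc A B C :
  ret3_r A B C ∘ α' A B C ∘ sec3_l A B C ∘ ret3_l A B C
  = ret3_r A B C ∘ α' A B C.
Proof.
crw sec_ret3_l; crw (eq_sym (assoc_tens_idem3 _ _ _)).
by rewrite ret_sec3_r comp_idl.
Qed.

Lemma sec3_l_assoc_inv A B C :
  sec3_l A B C ∘ (ret3_l A B C ∘ inv (α' A B C) ∘ sec3_r A B C)
  = inv (α' A B C) ∘ sec3_r A B C.
Proof.
apply: (@iso_mono _ _ _ (α' A B C)).
bracket_left; rewrite fwd_inv comp_idl.
crw sec_ret3_l; crw (eq_sym (assoc_tens_idem3 _ _ _)).
crw fwd_inv; rewrite comp_idr.
by crw ret_sec3_r; rewrite comp_idr.
Qed.

Lemma box_assoc_inv_fwd A B C :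
  ret3_l A B C ∘ inv (α' A B C) ∘ sec3_r A B C
    ∘ (ret3_r A B C ∘ α' A B C ∘ sec3_l A B C) = idm _.
Proof.
rewrite (comp_assoc _ (sec3_r A B C)) sec3_r_assoc; bracket_left.
by crw inv_fwd; rewrite comp_idr ret_sec3_l.
Qed.

Lemma box_assoc_fwd_inv A B C :
  ret3_r A B C ∘ α' A B C ∘ sec3_l A B C
    ∘ (ret3_l A B C ∘ inv (α' A B C) ∘ sec3_r A B C) = idm _.
Proof.
rewrite (comp_assoc _ (sec3_l A B C)) sec3_l_assoc_inv; bracket_left.
by crw fwd_inv; rewrite comp_idr ret_sec3_r.
Qed.

Definition box_assoc A B C :
    @Iso (EM T) (box (box A B) C) (box A (box B C)).
Proof.
exact: (@alg_iso _ _ (box (box A B) C) (box A (box B C))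
          (@Build_AlgHom _ _ (box (box A B) C) (box A (box B C)) _
             (box_assoc_action A B C)) _
          (box_assoc_inv_fwd A B C) (box_assoc_fwd_inv A B C)).
Defined.

Lemma box_sec_assoc A B C :
  (idm (carrier A) ⊗' ii B C) ∘ ii A (box B C) ∘ ahom (fwd (box_assoc A B C))
  = α' A B C ∘ (ii A B ⊗' idm (carrier C)) ∘ ii (box A B) C.
Proof.
by rewrite -/(sec3_r A B C) [ahom _]/= sec3_r_assoc {1}/sec3_l; bracket_left.
Qed.

Lemma box_ret_assoc A B C :
  ahom (fwd (box_assoc A B C)) ∘ pp (box A B) C ∘ (pp A B ⊗' idm (carrier C))
  = pp A (box B C) ∘ (idm (carrier A) ⊗' pp B C) ∘ α' A B C.
Proof.
rewrite comp_assoc -/(ret3_l A B C) [ahom _]/= ret3_l_assoc {1}/ret3_r.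
by bracket_left.
Qed.

Lemma box_sec3_r_mono A B C X (f g : Hom X (carrier (box A (box B C)))) :
  (idm (carrier A) ⊗' ii B C) ∘ ii A (box B C) ∘ f
  = (idm (carrier A) ⊗' ii B C) ∘ ii A (box B C) ∘ g -> f = g.
Proof.
move=> /(f_equal (comp (ret3_r A B C))).
by rewrite -/(sec3_r A B C); bracket_left; rewrite ret_sec3_r !comp_idl.
Qed.

(** * The Frobenius laws *)

Hypotheses (HW3 : W3 t) (HW4 : W4 t).

Lemma tens_idem_box_ret_l A B C :
  E (box A B) C ∘ (pp A B ⊗' idm (carrier C))
  = (pp A B ⊗' idm (carrier C)) ∘ tens_idem3 A B C.
Proof.
rewrite (tens_idemE (box A B) C) tens_idem3E comp_assoc meta_nat; bracket_left.
by rewrite tens_action_box_ret_l.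
Qed.

Lemma tens_idem_box_sec_l A B C :
  (ii A B ⊗' idm (carrier C)) ∘ E (box A B) C
  = tens_idem3 A B C ∘ (ii A B ⊗' idm (carrier C)).
Proof.
rewrite (tens_idemE (box A B) C) tens_idem3E comp_assoc meta_nat; bracket_left.
by rewrite tens_action_box_sec_l.
Qed.

Lemma tens_idem_box_ret_r A B C :
  E A (box B C) ∘ (idm (carrier A) ⊗' pp B C)
  = (idm (carrier A) ⊗' pp B C) ∘ φr A B C ∘ u _.
Proof.
rewrite (tens_idemE A (box B C)) comp_assoc meta_nat; bracket_left.
by rewrite tens_action_box_ret_r.
Qed.

Lemma tens_idem_box_sec_r A B C :
  (idm (carrier A) ⊗' ii B C) ∘ E A (box B C)
  = φr A B C ∘ u _ ∘ (idm (carrier A) ⊗' ii B C).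
Proof.
rewrite (tens_idemE A (box B C)) (comp_assoc _ (u _)) meta_nat; bracket_left.
by rewrite tens_action_box_sec_r.
Qed.

Lemma assoc_inv_tens_idem3 A B C :
  tens_idem3 A B C ∘ inv (α' A B C) = inv (α' A B C) ∘ φr A B C ∘ u _.
Proof.
rewrite tens_idem3E comp_assoc meta_nat; bracket_left.
by rewrite assoc_inv_tens_action3.
Qed.

(** The right side is the left side flanked by the idempotents of the two outer box products. Moved
    inside, these merge into one [tens_idem3], which W3 factors into binary idempotents absorbed by
    [pp A B] and [ii B C]. *)
Lemma box_frobenius_l A B C :
  (pp A B ⊗' idm (carrier C)) ∘ inv (α' A B C) ∘ (idm (carrier A) ⊗' ii B C)
  = ii (box A B) C ∘ ahom (inv (box_assoc A B C)) ∘ pp A (box B C).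
Proof.
have -> : ahom (inv (box_assoc A B C))
    = ret3_l A B C ∘ inv (α' A B C) ∘ sec3_r A B C by [].
rewrite /ret3_l /sec3_r; bracket_left.
rewrite spl_sec_ret; crw spl_sec_ret; rewrite tens_idem_box_ret_l.
crw assoc_inv_tens_idem3; crw (eq_sym (tens_idem_box_sec_r _ _ _)).
crw tens_idem_idem; crw tens_idem_box_sec_r.
crw (eq_sym (assoc_inv_tens_idem3 _ _ _)).
rewrite -(tens_idem3_W3 HW3); crw fwd_inv; rewrite comp_idr.
by do 2 crw tensm_comp_r; rewrite !comp_idl spl_ret_idem spl_idem_sec.
Qed.

Lemma box_frobenius_r A B C :
  (idm (carrier A) ⊗' pp B C) ∘ α' A B C ∘ (ii A B ⊗' idm (carrier C))
  = ii A (box B C) ∘ ahom (fwd (box_assoc A B C)) ∘ pp (box A B) C.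
Proof.
have -> : ahom (fwd (box_assoc A B C))
    = ret3_r A B C ∘ α' A B C ∘ sec3_l A B C by [].
rewrite /ret3_r /sec3_l; bracket_left.
rewrite spl_sec_ret; crw spl_sec_ret; rewrite tens_idem_box_ret_r.
crw (eq_sym (sec_ret3_r _ _ _)); crw assoc_tens_idem3.
crw (eq_sym (tens_idem_box_sec_l _ _ _)).
crw tens_idem_idem; crw tens_idem_box_sec_l.
rewrite -(tens_idem3_W4 HW4); bracket_left; crw fwd_inv; rewrite comp_idr.
by do 2 crw tensm_comp_r; rewrite !comp_idl spl_ret_idem spl_idem_sec.
Qed.

End OpmonoidalMonad.

(** * The reversed tensor product *)

Section Reversal.

Variable M : Category.

Definition iso_inv (X Y : M) (f : Iso X Y) : Iso Y X :=
  {| inv_fwd := fwd_inv f; fwd_inv := inv_fwd f |}.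

Variable V : Monoidal M.

Local Notation "X ⊗ Y" := (tens V X Y) (at level 35, right associativity).
Local Notation "f ⊗' g" := (tensm V f g) (at level 35, right associativity).
Local Notation K := (munit V).
Local Notation α := (assoc V).

Lemma pentagon_rev X Y Z W :
  inv (α (W ⊗ Z) Y X) ∘ inv (α W Z (Y ⊗ X))
  = (inv (α W Z Y) ⊗' idm X) ∘ inv (α W (Z ⊗ Y) X)
      ∘ (idm W ⊗' inv (α Z Y X)).
Proof.
apply: (@iso_mono _ _ _ (α (W ⊗ Z) Y X)).
apply: (@iso_mono _ _ _ (α W Z (Y ⊗ X))).
crw fwd_inv; rewrite comp_idr fwd_inv pentagon.
crw tensm_comp_r; rewrite fwd_inv comp_idl tensm_id comp_idr.
crw fwd_inv; rewrite comp_idr tensm_comp_r fwd_inv comp_idl.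
by rewrite tensm_id.
Qed.

Lemma triangle_rev X Y :
  (runit V Y ⊗' idm X) ∘ inv (α Y K X) = idm Y ⊗' lunit V X.
Proof. by rewrite -triangle; crw fwd_inv; rewrite comp_idr. Qed.

(** Passing to this structure exchanges left and right: W2 for [t] is convertible to W1 for
    [rev_opmonoidal t], so one-sided results need only be proved once. *)
Definition rev_monoidal : Monoidal M :=
  {| tens := fun X Y => Y ⊗ X;
     tensm := fun X X' Y Y' f g => g ⊗' f;
     tensm_id := fun X Y => tensm_id V Y X;
     tensm_comp := fun _ _ _ _ _ _ f' f g' g => tensm_comp V g' g f' f;
     munit := K;
     assoc := fun X Y Z => iso_inv (α Z Y X);
     lunit := runit V;
     runit := lunit V;
     assoc_nat := fun _ _ _ _ _ _ f g h => assoc_inv_nat V h g f;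
     lunit_nat := fun _ _ f => runit_nat V f;
     runit_nat := fun _ _ f => lunit_nat V f;
     pentagon := pentagon_rev;
     triangle := triangle_rev |}.

Lemma runit_tens X Y : (idm X ⊗' runit V Y) ∘ α X Y K = runit V (X ⊗ Y).
Proof.
apply: (@iso_epi _ _ _ (iso_inv (α X Y K))) => /=.
crw fwd_inv; rewrite comp_idr.
exact: (eq_sym (lunit_tens rev_monoidal Y X)).
Qed.

Lemma assoc_runit_inv X Y :
  α X Y K ∘ inv (runit V (X ⊗ Y)) = idm X ⊗' inv (runit V Y).
Proof.
apply: (@iso_epi _ _ _ (runit V (X ⊗ Y))).
rewrite comp_assoc inv_fwd comp_idr -runit_tens; bracket_left.
by rewrite tensm_comp_r inv_fwd !comp_idl tensm_id comp_idl.
Qed.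

Variable T : Monad M.

Definition rev_opmonoidal (t : OpmonoidalData V V T) :
    OpmonoidalData rev_monoidal rev_monoidal T :=
  @Build_OpmonoidalData _ _ rev_monoidal rev_monoidal T
    (fun X Y => nu t Y X) (nu0 t).

Lemma rev_is_opmonoidal (t : OpmonoidalData V V T) :
  IsOpmonoidal t -> IsOpmonoidal (rev_opmonoidal t).
Proof.
move=> H; split=> /= [X X' Y Y' f g|X Y Z|X|X].
- exact: nu_nat.
- apply: (@iso_mono _ _ _ (α (T Z) (T Y) (T X))); bracket_left.
  rewrite fwd_inv comp_idl; crw (nu_coassoc H).
  by crw fmap_comp_r; rewrite fwd_inv fmap_id comp_idr.
- exact: nu_rcounit.
- exact: nu_lcounit.
Qed.

End Reversal.

(** * The unit constraints *)

Section UnitAlgebra.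

Variables (M : Category) (T : Monad M).

Local Notation m := (mmul T).
Local Notation u := (meta T).
Local Notation "'TT' f" := (fmap T f) (at level 10, f at level 9).

Section Counital.

Variables (V : Monoidal M) (t : OpmonoidalData V V T).
Hypotheses (Ht : IsOpmonoidal t) (HW1 : W1 t).

Local Notation "X ⊗ Y" := (tens V X Y) (at level 35, right associativity).
Local Notation "f ⊗' g" := (tensm V f g) (at level 35, right associativity).
Local Notation K := (munit V).
Local Notation τ := (nu t).
Local Notation τ0 := (nu0 t).

(* For [T = H ⊗ -] with [H] a weak bialgebra this is [h ↦ 1_1 ε(1_2 h)], and
   its mirror image, obtained from the reversed tensor product, is
   [h ↦ ε(1_1 h) 1_2]. *)
Definition counit_idem : Hom (T K) (T K) :=
  runit V (T K) ∘ (idm (T K) ⊗' (τ0 ∘ m K)) ∘ τ K (T K) ∘ u (K ⊗ T K)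
    ∘ inv (lunit V (T K)).

(** This is W1 at [K], followed by [τ0] and preceded by the inverse left unitor under [T]. On the
    right [τ0] then evaluates both tensor factors; as the two unitors agree on [K], the left counit
    law removes one of them. *)
Lemma counit_idem_counit : τ0 ∘ m K ∘ TT counit_idem = τ0 ∘ m K.
Proof.
have /(f_equal (fun x => τ0 ∘ x ∘ TT (inv (lunit V (T K))))) := HW1 K.
bracket_left; do 5 crw fmap_comp_r; crw tensm_comp_r; rewrite comp_idl.
crw tensm_comp_r; rewrite comp_idl.
rewrite -/counit_idem => ->.
rewrite -runit_nat; crw tensm_comp_r; rewrite comp_idl comp_idr.
rewrite -lunit_unit.
have -> : τ0 ⊗' (τ0 ∘ m K) = (idm K ⊗' (τ0 ∘ m K)) ∘ (τ0 ⊗' idm _).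
  by rewrite tensm_comp_r comp_idl comp_idr.
bracket_left; rewrite lunit_nat; crw (nu_lcounit Ht); crw fmap_comp_r.
by rewrite fwd_inv fmap_id comp_idr.
Qed.

(** By naturality [h] moves into the second tensor factor, where [counit_idem] sees it only through
    [τ0 ∘ m]. *)
Lemma counit_idem_eq X (f g : Hom X (T K)) :
  τ0 ∘ m K ∘ TT f = τ0 ∘ m K ∘ TT g -> counit_idem ∘ f = counit_idem ∘ g.
Proof.
have expand h : counit_idem ∘ h
    = runit V (T K) ∘ (idm (T K) ⊗' (τ0 ∘ m K ∘ TT h)) ∘ τ K X ∘ u (K ⊗ X)
      ∘ inv (lunit V X).
  rewrite /counit_idem; crw lunit_inv_nat; crw meta_nat.
  crw (eq_sym (nu_nat Ht _ _)); crw tensm_comp_r.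
  by rewrite fmap_id comp_idl; bracket_left.
by rewrite !expand => ->.
Qed.

Lemma counit_idem_absorb (c : Hom (T K) (T K)) :
  τ0 ∘ m K ∘ TT c = τ0 ∘ m K -> counit_idem ∘ c = counit_idem.
Proof.
move=> Hc; rewrite -[RHS]comp_idr; apply: counit_idem_eq.
by rewrite Hc fmap_id comp_idr.
Qed.

(** This is what lets the multiplication of [TK] descend to an action on the splitting of
    [counit_idem]. *)
Lemma counit_idem_mul_absorb (c : Hom (T K) (T K)) :
  τ0 ∘ m K ∘ TT c = τ0 ∘ m K ->
  counit_idem ∘ m K ∘ TT c = counit_idem ∘ m K.
Proof.
move=> Hc; rewrite comp_assoc; apply: counit_idem_eq.
rewrite fmap_comp; crw mmul_assoc; crw mmul_nat.
by rewrite Hc.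
Qed.

Lemma counit_counit_idem : τ0 ∘ counit_idem = τ0.
Proof.
have /(f_equal (fun x => x ∘ u (T K))) := counit_idem_counit.
rewrite (comp_assoc _ _ (u _)) -meta_nat; bracket_left.
by crw mmul_etal; rewrite !comp_idr.
Qed.

End Counital.

(** * The right unit constraint, over an abstract quotient [R] of [TK] *)

Section RightUnit.

Variables (V : Monoidal M) (t : OpmonoidalData V V T).
Hypotheses (Ht : IsOpmonoidal t) (HW1 : W1 t) (HW2 : W2 t).

Local Notation "X ⊗ Y" := (tens V X Y) (at level 35, right associativity).
Local Notation "f ⊗' g" := (tensm V f g) (at level 35, right associativity).
Local Notation K := (munit V).
Local Notation α := (assoc V).
Local Notation τ := (nu t).
Local Notation τ0 := (nu0 t).
Local Notation φ := (tens_action t).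
Local Notation E := (tens_idem t).
Local Notation cap' := (counit_idem (rev_opmonoidal t)).

Variables (R : Algebra T) (q : AlgHom (free_alg T K) R).
Variables (s : Hom (carrier R) (T K)) (i0 : Hom (carrier R) K).
Hypotheses (qs : ahom q ∘ s = idm _) (i0q : i0 ∘ ahom q = τ0).
Hypothesis q_absorb : ahom q ∘ m K ∘ TT cap' = ahom q ∘ m K.

Local Notation p0 := (ahom q ∘ u K).

Variable A : Algebra T.

Definition tens_counit : Hom (carrier A ⊗ carrier R) (carrier A) :=
  runit V (carrier A) ∘ (idm (carrier A) ⊗' i0).

Local Notation F := (free_alg T K).
Local Notation ρ := (runit V (carrier A) ∘ (idm (carrier A) ⊗' τ0)).

(** As [q] is a split epimorphism, identities on [A ⊗ R] may be checked on [A ⊗ TK]. *)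
Lemma tens_free_epi X (f g : Hom (carrier A ⊗ carrier R) X) :
  f ∘ (idm (carrier A) ⊗' ahom q) = g ∘ (idm (carrier A) ⊗' ahom q) -> f = g.
Proof.
move=> /(f_equal (fun x => x ∘ (idm (carrier A) ⊗' s))).
by rewrite !comp_assoc tensm_comp_r qs comp_idl tensm_id !comp_idr.
Qed.

Lemma tens_counit_free : tens_counit ∘ (idm (carrier A) ⊗' ahom q) = ρ.
Proof. by rewrite /tens_counit; crw tensm_comp_r; rewrite i0q comp_idl. Qed.

Lemma tens_idem_free :
  E A R ∘ (idm (carrier A) ⊗' ahom q) = (idm (carrier A) ⊗' ahom q) ∘ E A F.
Proof. exact: (tens_idem_nat Ht (alg_id A) q). Qed.

Lemma tens_action_free :
  φ A R ∘ TT (idm (carrier A) ⊗' ahom q)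
  = (idm (carrier A) ⊗' ahom q) ∘ φ A F.
Proof. exact: (tens_action_nat Ht (alg_id A) q). Qed.

(** This is W1 at the carrier of [A], followed by the action of [A]. *)
Lemma tens_counit_free_action : action A ∘ TT (ρ ∘ E A F) = ρ ∘ φ A F.
Proof.
have /(f_equal (comp (action A))) := HW1 (carrier A).
bracket_left; rewrite action_mul; do 4 crw fmap_comp_r; bracket_left.
rewrite -runit_nat; do 3 crw tensm_comp_r; rewrite !comp_idl !comp_idr.
crw fmap_comp_r; rewrite -runit_nat; crw tensm_comp_r.
rewrite comp_idl comp_idr tens_idemE tens_actionE => H.
by crw tensm_comp_r; rewrite !comp_idl.
Qed.

Lemma tens_counit_action :
  action A ∘ TT (tens_counit ∘ E A R) = tens_counit ∘ φ A R.
Proof.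
rewrite -(comp_idr (tens_counit ∘ φ A R)).
have <- : TT (idm (carrier A) ⊗' ahom q) ∘ TT (idm (carrier A) ⊗' s) = idm _.
  by rewrite fmap_comp_r tensm_comp_r qs comp_idl tensm_id fmap_id.
crw tens_action_free; rewrite tens_counit_free -tens_counit_free_action.
rewrite comp_assoc fmap_comp_r -tens_counit_free.
crw (eq_sym tens_idem_free); crw tensm_comp_r.
by rewrite qs comp_idl tensm_id comp_idr.
Qed.

(** On [A ⊗ TK] the multiplication cancels the unit of [TK], and the right counit law of [τ]
    collapses the rest. *)
Lemma tens_counit_unit :
  tens_counit ∘ E A R ∘ (idm (carrier A) ⊗' p0) = runit V (carrier A).
Proof.
rewrite -{1}(comp_idl (idm (carrier A))) tensm_comp.
crw tens_idem_free; rewrite tens_counit_free.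
rewrite tens_idemE tens_actionE; bracket_left.
crw meta_nat; crw (eq_sym (nu_nat Ht _ _)).
do 2 crw tensm_comp_r.
rewrite fmap_id comp_idl comp_idr; crw mmul_etar; rewrite comp_idr.
have -> : action A ⊗' τ0 = (action A ⊗' idm K) ∘ (idm _ ⊗' τ0).
  by rewrite tensm_comp_r comp_idl comp_idr.
bracket_left; rewrite runit_nat; crw (nu_rcounit Ht).
crw (eq_sym (meta_nat T (runit V (carrier A)))).
by rewrite action_unit comp_idl.
Qed.

(** W2 at [K] trades the outer [m] and inner [u] for a single [τ], the shape that coassociativity
    produces in [tens_counit_free_unit]. *)
Lemma mul_counit_idem_rev :
  m K ∘ TT cap'
  = lunit V (T K) ∘ ((τ0 ∘ m K) ⊗' idm (T K)) ∘ τ (T K) K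
      ∘ TT (inv (runit V (T K))).
Proof.
have /(f_equal (fun x => x ∘ TT (inv (runit V (T K))))) := HW2 K.
bracket_left; do 5 crw fmap_comp_r; crw tensm_comp_r; rewrite comp_idl.
exact.
Qed.

(** Going to [A] and back inserts [cap'] in the right factor. Naturality brings [ρ ∘ E A F] under
    the action, where W1 applies; coassociativity then regroups the three factors, and the last two
    form [m K ∘ T cap']. *)
Lemma tens_counit_free_unit :
  (action A ⊗' idm (T K)) ∘ τ (carrier A) K ∘ u _
    ∘ inv (runit V (carrier A)) ∘ (ρ ∘ E A F)
  = (action A ⊗' (m K ∘ TT cap')) ∘ τ (carrier A) (T K) ∘ u _.
Proof.
rewrite mul_counit_idem_rev.
move: tens_counit_free_action; set r := ρ ∘ E A F => Hr.
crw (runit_inv_nat V r); crw meta_nat; crw (eq_sym (nu_nat Ht _ _)).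
crw tensm_comp_r; rewrite Hr fmap_id comp_idl tens_actionE.
have -> : (ρ ∘ ((action A ⊗' m K) ∘ τ (carrier A) (T K))) ⊗' idm (T K)
    = (runit V (carrier A) ⊗' idm (T K))
      ∘ ((action A ⊗' (τ0 ∘ m K)) ⊗' idm (T K)) ∘ (τ _ _ ⊗' idm (T K)).
  rewrite !tensm_comp_r !comp_idl; bracket_left.
  by crw tensm_comp_r; rewrite comp_idl.
rewrite -triangle; crw (assoc_nat V); crw (nu_coassoc Ht).
crw (eq_sym (meta_nat T (α (carrier A) (T K) K))); crw assoc_runit_inv.
crw meta_nat; crw (eq_sym (nu_nat Ht _ _)).
do 3 crw tensm_comp_r.
by rewrite fmap_id !comp_idl !comp_idr.
Qed.

(** Checked on [A ⊗ TK], where the [cap'] inserted by [tens_counit_free_unit] is absorbed by [q]. *)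
Lemma tens_counit_unit_idem :
  E A R ∘ (idm (carrier A) ⊗' p0) ∘ inv (runit V (carrier A))
    ∘ tens_counit ∘ E A R = E A R.
Proof.
apply: tens_free_epi.
rewrite tens_idem_free; crw tens_idem_free; crw tens_counit_free.
rewrite -{1}(comp_idl (idm (carrier A))) tensm_comp.
crw tens_idem_free.
have step : E A F ∘ (idm (carrier A) ⊗' u K)
    = (action A ⊗' idm (T K)) ∘ τ (carrier A) K ∘ u _.
  rewrite tens_idemE tens_actionE; crw meta_nat; crw (eq_sym (nu_nat Ht _ _)).
  by crw tensm_comp_r; rewrite mmul_etar fmap_id comp_idr.
crw step.
have := f_equal (comp (idm (carrier A) ⊗' ahom q)) tens_counit_free_unit.
bracket_left => ->.
rewrite tens_idemE tens_actionE; do 2 crw tensm_comp_r.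
by crw q_absorb.
Qed.

End RightUnit.
End UnitAlgebra.

(** * The weak bimonad of an opmonoidal monad *)

Section FromOpmonoidal.

Variables (M : Category) (V : Monoidal M) (T : Monad M).
Hypothesis split : idempotents_split M.
Variable t : OpmonoidalData V V T.
Hypothesis Ht : IsOpmonoidal t.
Hypotheses (HW1 : W1 t) (HW2 : W2 t) (HW3 : W3 t) (HW4 : W4 t) (HW5 : W5 t).

Local Notation "f ⊗' g" := (tensm V f g) (at level 35, right associativity).
Local Notation K := (munit V).
Local Notation m := (mmul T).
Local Notation u := (meta T).
Local Notation α := (assoc V).
Local Notation τ0 := (nu0 t).
Local Notation "'TT' f" := (fmap T f) (at level 10, f at level 9).
Local Notation E := (tens_idem t).
Local Notation cap := (counit_idem t).
Local Notation cap' := (counit_idem (rev_opmonoidal t)).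
Local Notation pp A B := (spl_ret (box_splitting Ht HW5 split A B)).
Local Notation ii A B := (spl_sec (box_splitting Ht HW5 split A B)).
Local Notation "A □ B" := (box Ht HW5 split A B) (at level 35).
Local Notation "f □' g" := (boxm Ht HW5 split f g) (at level 35).

Implicit Types A B C D : Algebra T.

Lemma counit_cap : τ0 ∘ m K ∘ TT cap = τ0 ∘ m K.
Proof. exact: counit_idem_counit. Qed.

Lemma counit_cap_rev : τ0 ∘ m K ∘ TT cap' = τ0 ∘ m K.
Proof. exact: (counit_idem_counit (rev_is_opmonoidal Ht) HW2). Qed.

(* The mirror image [cap'] has the same quotient as [cap], since each absorbs
   the other; hence one splitting serves both unit constraints. *)
Definition unit_splitting : Splitting cap :=
  choose_splitting split (counit_idem_absorb Ht counit_cap).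

Local Notation q := (spl_ret unit_splitting).
Local Notation s := (spl_sec unit_splitting).

Lemma unit_ret_absorb (c : Hom (T K) (T K)) :
  τ0 ∘ m K ∘ TT c = τ0 ∘ m K -> q ∘ m K ∘ TT c = q ∘ m K.
Proof.
move=> /(counit_idem_mul_absorb Ht) /(f_equal (comp q)).
by bracket_left; rewrite spl_ret_idem.
Qed.

Lemma unit_action_unit : q ∘ m K ∘ TT s ∘ u _ = idm _.
Proof.
crw (eq_sym (meta_nat T s)); crw mmul_etal.
by rewrite comp_idr spl_ret_sec.
Qed.

Lemma unit_action_ret : q ∘ m K ∘ TT s ∘ TT q = q ∘ m K.
Proof.
by crw fmap_comp_r; rewrite spl_sec_ret unit_ret_absorb //; apply: counit_cap.
Qed.

Lemma unit_action_mul :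
  q ∘ m K ∘ TT s ∘ m _ = q ∘ m K ∘ TT s ∘ TT (q ∘ m K ∘ TT s).
Proof.
rewrite !fmap_comp; bracket_left; rewrite unit_action_ret.
by crw mmul_assoc; crw (eq_sym (mmul_nat T s)).
Qed.

Definition unit_alg : Algebra T :=
  {| action_unit := unit_action_unit; action_mul := unit_action_mul |}.

Local Notation R := unit_alg.

Definition unit_quot : AlgHom (free_alg T K) R :=
  @Build_AlgHom _ _ (free_alg T K) R q (eq_sym unit_action_ret).

Definition unit_counit : Hom (carrier R) K := locked (τ0 ∘ s).

Local Notation i0 := unit_counit.
Local Notation p0 := (q ∘ u K).

Lemma unit_counit_quot : i0 ∘ q = τ0.
Proof.
rewrite /unit_counit -lock; crw spl_sec_ret.
exact: counit_counit_idem.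
Qed.

Lemma unit_quot_absorb : ahom unit_quot ∘ m K ∘ TT cap = ahom unit_quot ∘ m K.
Proof. exact: (unit_ret_absorb counit_cap). Qed.

Lemma unit_quot_absorb_rev :
  ahom unit_quot ∘ m K ∘ TT cap' = ahom unit_quot ∘ m K.
Proof. exact: (unit_ret_absorb counit_cap_rev). Qed.

Local Notation r A := (runit V (carrier A) ∘ (idm (carrier A) ⊗' i0)).
Local Notation l A := (lunit V (carrier A) ∘ (i0 ⊗' idm (carrier A))).

Lemma box_runit_unit A :
  r A ∘ E A R ∘ (idm (carrier A) ⊗' p0) = runit V (carrier A).
Proof. exact: (tens_counit_unit Ht (q := unit_quot) unit_counit_quot). Qed.

Lemma box_lunit_unit A :
  l A ∘ E R A ∘ (p0 ⊗' idm (carrier A)) = lunit V (carrier A).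
Proof.
exact: (tens_counit_unit (rev_is_opmonoidal Ht) (q := unit_quot)
          unit_counit_quot A).
Qed.

Definition box_runit A : @Iso (EM T) (A □ R) A.
Proof.
apply: (@box_iso _ _ _ _ Ht HW5 split A R A (r A)
          ((idm (carrier A) ⊗' p0) ∘ inv (runit V (carrier A)))).
- exact: (tens_counit_action Ht HW1 (q := unit_quot) (spl_ret_sec _)
            unit_counit_quot).
- by bracket_left; rewrite box_runit_unit fwd_inv.
- have := tens_counit_unit_idem Ht HW1 HW2 (q := unit_quot) (spl_ret_sec _)
            unit_counit_quot unit_quot_absorb_rev A.
  by rewrite /tens_counit; bracket_left.
Defined.

(** This is the right unit constraint of the reversed structure, with W1 and W2 trading places. *)
Definition box_lunit A : @Iso (EM T) (R □ A) A.
Proof.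
apply: (@box_iso _ _ _ _ Ht HW5 split R A A (l A)
          ((p0 ⊗' idm (carrier A)) ∘ inv (lunit V (carrier A)))).
- exact: (tens_counit_action (rev_is_opmonoidal Ht) HW2 (q := unit_quot)
            (spl_ret_sec _) unit_counit_quot).
- by bracket_left; rewrite box_lunit_unit fwd_inv.
- have := tens_counit_unit_idem (rev_is_opmonoidal Ht) HW2 HW1
            (q := unit_quot) (spl_ret_sec _) unit_counit_quot
            unit_quot_absorb A.
  by rewrite /tens_counit /=; bracket_left.
Defined.

(** * Coherence of the box product *)

Lemma box_sec_mono A B X (f g : Hom X (carrier (A □ B))) :
  ii A B ∘ f = ii A B ∘ g -> f = g.
Proof. exact: spl_sec_mono. Qed.

Lemma boxm_id A B : alg_id A □' alg_id B = alg_id (A □ B).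
Proof.
apply/AlgHom_eq/box_sec_mono.
by rewrite box_sec_nat /= tensm_id comp_idl comp_idr.
Qed.

Lemma boxm_comp A A' A'' B B' B'' (f' : AlgHom A' A'') (f : AlgHom A A')
    (g' : AlgHom B' B'') (g : AlgHom B B') :
  alg_comp f' f □' alg_comp g' g = alg_comp (f' □' g') (f □' g).
Proof.
apply/AlgHom_eq/box_sec_mono.
rewrite box_sec_nat.
rewrite -[ahom (alg_comp (_ □' _) _)]/(ahom (_ □' _) ∘ ahom (_ □' _)).
bracket_left; rewrite box_sec_nat; crw box_sec_nat.
by rewrite tensm_comp_r.
Qed.

Local Notation a A B C := (ahom (fwd (box_assoc Ht HW5 split A B C))).
Local Notation id A := (idm (carrier A)).

Lemma box_assoc_nat A A' B B' C C'
    (f : AlgHom A A') (g : AlgHom B B') (h : AlgHom C C') :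
  a A' B' C' ∘ ahom ((f □' g) □' h) = ahom (f □' (g □' h)) ∘ a A B C.
Proof.
apply: box_sec3_r_mono; bracket_left.
rewrite box_sec_assoc; crw box_sec_nat; crw box_sec_nat.
crw tensm_comp_r; crw tensm_comp_r; rewrite !box_sec_nat !comp_idl.
have -> : ahom f ⊗' ((ahom g ⊗' ahom h) ∘ ii B C)
    = (ahom f ⊗' (ahom g ⊗' ahom h)) ∘ (id A ⊗' ii B C).
  by rewrite tensm_comp_r comp_idr.
crw box_sec_assoc; crw (eq_sym (assoc_nat V (ahom f) (ahom g) (ahom h))).
by crw tensm_comp_r; rewrite comp_idr.
Qed.

Lemma box_sec4_r_mono A B C D X (f g : Hom X (carrier (A □ (B □ (C □ D))))) :
  (id A ⊗' (id B ⊗' ii C D)) ∘ (id A ⊗' ii B (C □ D)) ∘ ii A (B □ (C □ D)) ∘ f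
  = (id A ⊗' (id B ⊗' ii C D)) ∘ (id A ⊗' ii B (C □ D))
      ∘ ii A (B □ (C □ D)) ∘ g ->
  f = g.
Proof.
rewrite -!tensm_idl_comp.
move=> /(f_equal (comp (id A ⊗' (pp B (C □ D) ∘ (id B ⊗' pp C D))))).
bracket_left; rewrite -!tensm_idl_comp; bracket_left.
crw (eq_sym (tensm_idl_comp V (carrier B) (pp C D) (ii C D))).
rewrite !spl_ret_sec !tensm_id comp_idr spl_ret_sec !tensm_id !comp_idl.
exact: (@box_sec_mono A (B □ (C □ D))).
Qed.

(** The iterated section into the fourfold tensor product is monic and intertwines the associators,
    so the pentagon is inherited from [M]. *)
Lemma box_pentagon A B C D :
  a A B (C □ D) ∘ a (A □ B) C D
  = ahom (alg_id A □' fwd (box_assoc Ht HW5 split B C D))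
      ∘ a A (B □ C) D
      ∘ ahom (fwd (box_assoc Ht HW5 split A B C) □' alg_id D).
Proof.
apply: box_sec4_r_mono; bracket_left.
(* The common form of both sides: the iterated section of the leftmost bracketing, followed by two
   associators of [M]. *)
transitivity (α _ _ _ ∘ α _ _ _ ∘ ((ii A B ⊗' id C) ⊗' id D)
  ∘ (ii (A □ B) C ⊗' id D) ∘ ii ((A □ B) □ C) D).
  crw box_sec_assoc; crw (eq_sym (assoc_nat V (id A) (id B) (ii C D))).
  rewrite tensm_id; crw (eq_sym (tensm_exchange V (ii A B) (ii C D))).
  crw box_sec_assoc; rewrite -(tensm_id V (carrier C) (carrier D)).
  by crw (eq_sym (assoc_nat V (ii A B) (id C) (id D))).
crw (box_sec_nat Ht HW5 split (alg_id A)).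
do 2 crw (eq_sym (tensm_idl_comp V _ _ _)).
rewrite box_sec_assoc !tensm_idl_comp; crw box_sec_assoc.
crw (eq_sym (assoc_nat V (id A) (ii B C) (id D))).
crw (box_sec_nat Ht HW5 split _ (alg_id D)).
do 3 crw (eq_sym (tensm_idr_comp V _ _ _)).
rewrite box_sec_assoc !tensm_idr_comp; bracket_left.
by rewrite pentagon.
Qed.

Lemma box_triangle A B :
  ahom (alg_id A □' fwd (box_lunit B)) ∘ a A R B
  = ahom (fwd (box_runit A) □' alg_id B).
Proof.
apply: box_sec_mono; bracket_left; rewrite !box_sec_nat.
rewrite [ahom (fwd (box_lunit B))]/= [ahom (fwd (box_runit A))]/=.
rewrite !tensm_idl_comp !tensm_idr_comp; crw box_sec_assoc.
crw (eq_sym (assoc_nat V (id A) i0 (id B))).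
by rewrite triangle.
Qed.

Lemma box_lunit_nat A B (f : AlgHom A B) :
  ahom (fwd (box_lunit B)) ∘ ahom (alg_id R □' f)
  = ahom f ∘ ahom (fwd (box_lunit A)).
Proof.
rewrite [ahom (fwd (box_lunit B))]/= [ahom (fwd (box_lunit A))]/=.
crw box_sec_nat; crw (tensm_exchange V i0 (ahom f)).
by rewrite lunit_nat.
Qed.

Lemma box_runit_nat A B (f : AlgHom A B) :
  ahom (fwd (box_runit B)) ∘ ahom (f □' alg_id R)
  = ahom f ∘ ahom (fwd (box_runit A)).
Proof.
rewrite [ahom (fwd (box_runit B))]/= [ahom (fwd (box_runit A))]/=.
crw box_sec_nat; crw (eq_sym (tensm_exchange V (ahom f) i0)).
by rewrite runit_nat.
Qed.

Definition box_monoidal : Monoidal (EM T).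
Proof.
refine (@Build_Monoidal (EM T) (box Ht HW5 split)
  (fun A A' B B' f g => f □' g) boxm_id
  (fun _ _ _ _ _ _ f' f g' g => boxm_comp f' f g' g)
  R (box_assoc Ht HW5 split) box_lunit box_runit _ _ _ _ _) => *;
  apply: AlgHom_eq.
- exact: box_assoc_nat.
- exact: box_lunit_nat.
- exact: box_runit_nat.
- exact: box_pentagon.
- exact: box_triangle.
Defined.

Local Notation U := (forgetful T).

Definition box_mon : MonoidalData box_monoidal V U :=
  @Build_MonoidalData _ _ box_monoidal V U (fun A B => pp A B) p0.

Definition box_opmon : OpmonoidalData box_monoidal V U :=
  @Build_OpmonoidalData _ _ box_monoidal V U (fun A B => ii A B) i0.

Lemma box_is_mon : IsMonoidal box_mon.
Proof.
split=> [A A' B B' f g|A B C|A|A].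
- exact: (eq_sym (box_ret_nat Ht HW5 split f g)).
- exact: box_ret_assoc.
- have -> : fmap U (lunit box_monoidal A) = l A ∘ ii R A by [].
  by crw spl_sec_ret; apply: box_lunit_unit.
- have -> : fmap U (runit box_monoidal A) = r A ∘ ii A R by [].
  by crw spl_sec_ret; apply: box_runit_unit.
Qed.

Lemma box_is_opmon : IsOpmonoidal box_opmon.
Proof.
split=> [A A' B B' f g|A B C|A|A] //.
- exact: (eq_sym (box_sec_nat Ht HW5 split f g)).
- exact: (eq_sym (box_sec_assoc Ht HW5 split A B C)).
Qed.

Definition box_frobenius : SeparableFrobenius box_monoidal V U :=
  @Build_SeparableFrobenius _ _ box_monoidal V U box_mon box_opmon
    box_is_mon box_is_opmon
    (box_frobenius_l Ht HW5 split HW3) (box_frobenius_r Ht HW5 split HW4)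
    (fun A B => spl_ret_sec (box_splitting Ht HW5 split A B)).

Definition box_bimonad : WeakBimonad V T := Build_WeakBimonad box_frobenius.

(** On free algebras [ii ∘ pp] is [E], which [φ] absorbs, and the units cancel the multiplications
    in [φ]. For the counit, [s ∘ q] is [cap], which is absorbed likewise, and [i0 ∘ q] is [τ0]. *)
Lemma associated_box_bimonad :
  opmonoidal_eq (associated_opmonoidal box_bimonad) t.
Proof.
split=> [X Y|].
- set A := free_alg T X; set B := free_alg T Y.
  have -> : nu (associated_opmonoidal box_bimonad) X Y
      = ii A B ∘ action (A □ B) ∘ TT (pp A B) ∘ TT (u X ⊗' u Y) by [].
  rewrite box_sec_action; crw (fmap_comp_r T (ii A B) (pp A B)).
  rewrite spl_sec_ret.
  rewrite (tens_action_idem Ht HW5) tens_actionE; crw (eq_sym (nu_nat Ht _ _)).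
  by rewrite tensm_comp_r !mmul_etar tensm_id comp_idl.
- have -> : nu0 (associated_opmonoidal box_bimonad)
      = i0 ∘ (q ∘ m K ∘ TT s) ∘ TT (q ∘ u K) by [].
  rewrite (fmap_comp T q); crw (fmap_comp_r T s q).
  rewrite spl_sec_ret; crw (unit_ret_absorb counit_cap).
  by crw mmul_etar; rewrite comp_idr unit_counit_quot.
Qed.

End FromOpmonoidal.

(** * The opmonoidal structure of a weak bimonad *)

Section FreeLift.

Variables (M : Category) (T : Monad M) (X : M) (A : Algebra T).
Variable f : Hom X (carrier A).

Lemma free_lift_action :
  action A ∘ fmap T f ∘ mmul T X
  = action A ∘ fmap T (action A ∘ fmap T f).
Proof.
rewrite fmap_comp; bracket_left; rewrite -action_mul.
by crw mmul_nat.
Qed.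

Definition free_lift : AlgHom (free_alg T X) A :=
  @Build_AlgHom _ _ (free_alg T X) A _ free_lift_action.

Lemma free_lift_unit : ahom free_lift ∘ meta T X = f.
Proof.
rewrite /= comp_assoc -meta_nat; bracket_left.
by rewrite action_unit comp_idl.
Qed.

End FreeLift.

Section FromBimonad.

Variables (M : Category) (V : Monoidal M) (T : Monad M) (B : WeakBimonad V T).

Local Notation "X ⊗ Y" := (tens V X Y) (at level 35, right associativity).
Local Notation "f ⊗' g" := (tensm V f g) (at level 35, right associativity).
Local Notation K := (munit V).
Local Notation m := (mmul T).
Local Notation u := (meta T).
Local Notation α := (assoc V).
Local Notation "'TT' f" := (fmap T f) (at level 10, f at level 9).
Local Notation W := (wb_tens B).
Local Notation R := (munit W).
Local Notation "P □ Q" := (tens W P Q) (at level 35).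
Local Notation F := (free_alg T).
Local Notation id A := (idm (carrier A)).
Local Notation τ := (nu (associated_opmonoidal B)).
Local Notation τ0 := (nu0 (associated_opmonoidal B)).

Implicit Types P Q S : Algebra T.

Definition wb_ret P Q : Hom (carrier P ⊗ carrier Q) (carrier (P □ Q)) :=
  mu (sf_mon (wb_frob B)) P Q.
Definition wb_sec P Q : Hom (carrier (P □ Q)) (carrier P ⊗ carrier Q) :=
  nu (sf_opmon (wb_frob B)) P Q.
Definition wb_unit : Hom K (carrier R) := mu0 (sf_mon (wb_frob B)).
Definition wb_counit : Hom (carrier R) K := nu0 (sf_opmon (wb_frob B)).

Local Notation pp := wb_ret.
Local Notation ii := wb_sec.
Local Notation p0 := wb_unit.
Local Notation i0 := wb_counit.

(** The counterpart of [tens_action], defined from the splitting maps; [associated_nu_action]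
    identifies the two formulas. *)
Definition wb_action P Q :
    Hom (T (carrier P ⊗ carrier Q)) (carrier P ⊗ carrier Q) :=
  locked (ii P Q ∘ action (P □ Q) ∘ TT (pp P Q)).

Local Notation φ := wb_action.

Lemma wb_actionE P Q : φ P Q = ii P Q ∘ action (P □ Q) ∘ TT (pp P Q).
Proof. by rewrite /wb_action -lock. Qed.

Lemma wb_ret_sec P Q : pp P Q ∘ ii P Q = idm _.
Proof. exact: (sf_sep (wb_frob B)). Qed.

Lemma wb_ret_nat P P' Q Q' (f : AlgHom P P') (g : AlgHom Q Q') :
  pp P' Q' ∘ (ahom f ⊗' ahom g)
  = ahom (tensm W (f : @Hom (EM T) P P') (g : @Hom (EM T) Q Q')) ∘ pp P Q.
Proof. exact: (mu_nat (sf_is_mon (wb_frob B))). Qed.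

Lemma wb_sec_nat P P' Q Q' (f : AlgHom P P') (g : AlgHom Q Q') :
  (ahom f ⊗' ahom g) ∘ ii P Q
  = ii P' Q' ∘ ahom (tensm W (f : @Hom (EM T) P P') (g : @Hom (EM T) Q Q')).
Proof. exact: (nu_nat (sf_is_opmon (wb_frob B))). Qed.

Local Notation a P Q S := (ahom (fwd (assoc W P Q S))).
Local Notation a' P Q S := (ahom (inv (assoc W P Q S))).
Local Notation α' P Q S := (α (carrier P) (carrier Q) (carrier S)).

Lemma wb_ret_assoc P Q S :
  a P Q S ∘ pp (P □ Q) S ∘ (pp P Q ⊗' id S)
  = pp P (Q □ S) ∘ (id P ⊗' pp Q S) ∘ α' P Q S.
Proof. exact: (mu_assoc (sf_is_mon (wb_frob B))). Qed.

Lemma wb_sec_assoc P Q S :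
  α' P Q S ∘ (ii P Q ⊗' id S) ∘ ii (P □ Q) S
  = (id P ⊗' ii Q S) ∘ ii P (Q □ S) ∘ a P Q S.
Proof. exact: (nu_coassoc (sf_is_opmon (wb_frob B))). Qed.

Lemma wb_ret_lunit P :
  ahom (fwd (lunit W P)) ∘ pp R P ∘ (p0 ⊗' id P) = lunit V (carrier P).
Proof. exact: (mu_lunit (sf_is_mon (wb_frob B))). Qed.

Lemma wb_ret_runit P :
  ahom (fwd (runit W P)) ∘ pp P R ∘ (id P ⊗' p0) = runit V (carrier P).
Proof. exact: (mu_runit (sf_is_mon (wb_frob B))). Qed.

Lemma wb_sec_lunit P :
  lunit V (carrier P) ∘ (i0 ⊗' id P) ∘ ii R P = ahom (fwd (lunit W P)).
Proof. exact: (nu_lcounit (sf_is_opmon (wb_frob B))). Qed.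

Lemma wb_sec_runit P :
  runit V (carrier P) ∘ (id P ⊗' i0) ∘ ii P R = ahom (fwd (runit W P)).
Proof. exact: (nu_rcounit (sf_is_opmon (wb_frob B))). Qed.

Lemma wb_frob_l P Q S :
  (pp P Q ⊗' id S) ∘ inv (α' P Q S) ∘ (id P ⊗' ii Q S)
  = ii (P □ Q) S ∘ a' P Q S ∘ pp P (Q □ S).
Proof. exact: (sf_frob_l (wb_frob B)). Qed.

Lemma wb_frob_r P Q S :
  (id P ⊗' pp Q S) ∘ α' P Q S ∘ (ii P Q ⊗' id S)
  = ii P (Q □ S) ∘ a P Q S ∘ pp (P □ Q) S.
Proof. exact: (sf_frob_r (wb_frob B)). Qed.

Lemma wb_action_nat P P' Q Q' (f : AlgHom P P') (g : AlgHom Q Q') :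
  (ahom f ⊗' ahom g) ∘ φ P Q = φ P' Q' ∘ TT (ahom f ⊗' ahom g).
Proof.
rewrite !wb_actionE; bracket_left; rewrite wb_sec_nat.
crw (ahom_action (tensm W (f : @Hom (EM T) P P') (g : @Hom (EM T) Q Q'))).
by do 2 crw fmap_comp_r; rewrite wb_ret_nat.
Qed.

Lemma wb_action_assoc P Q : φ P Q ∘ TT (φ P Q) = φ P Q ∘ m _.
Proof.
rewrite !wb_actionE; crw fmap_comp_r; bracket_left.
rewrite wb_ret_sec comp_idl fmap_comp; bracket_left.
crw (eq_sym (action_mul (P □ Q))).
by crw mmul_nat.
Qed.

Lemma wb_action_unit P Q : φ P Q ∘ u _ = ii P Q ∘ pp P Q.
Proof.
rewrite wb_actionE; crw (eq_sym (meta_nat T (pp P Q))).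
by crw (action_unit (P □ Q)); rewrite comp_idr.
Qed.

(** [τ X Y] is this algebra map followed by [ii]. When [τ] occurs as a tensor factor, the
    factorization makes naturality of [φ] in algebra maps applicable. *)
Definition wb_lift X Y : AlgHom (F (X ⊗ Y)) (F X □ F Y) :=
  free_lift (pp (F X) (F Y) ∘ (u X ⊗' u Y)).

Definition wb_unit_lift : AlgHom (F K) R := free_lift p0.

Lemma associated_nu_lift X Y : τ X Y = ii (F X) (F Y) ∘ ahom (wb_lift X Y).
Proof. by rewrite /= fmap_comp; bracket_left. Qed.

Lemma associated_nu X Y : τ X Y = φ (F X) (F Y) ∘ TT (u X ⊗' u Y).
Proof. by rewrite wb_actionE. Qed.

Lemma associated_nu0 : τ0 = i0 ∘ ahom wb_unit_lift.
Proof. by rewrite /=; bracket_left. Qed.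

Definition action_hom P : AlgHom (F (carrier P)) P :=
  @Build_AlgHom _ _ (F (carrier P)) P (action P) (action_mul P).

(** Actions are algebra maps out of free algebras, so naturality carries [φ] from the free algebras
    to [P] and [Q], and the unit laws cancel [u]. *)
Lemma associated_nu_action P Q :
  (action P ⊗' action Q) ∘ τ (carrier P) (carrier Q) = φ P Q.
Proof.
rewrite associated_nu; bracket_left.
rewrite (wb_action_nat (action_hom P) (action_hom Q)).
crw fmap_comp_r; rewrite tensm_comp_r !action_unit tensm_id fmap_id.
by rewrite comp_idr.
Qed.

Lemma wb_lift_unit X Y :
  ahom (wb_lift X Y) ∘ u (X ⊗ Y) = pp (F X) (F Y) ∘ (u X ⊗' u Y).
Proof. exact: free_lift_unit. Qed.

Lemma associated_nu_lift_l X Y Z :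
  (ahom (wb_lift X Y) ⊗' idm (T Z)) ∘ τ (X ⊗ Y) Z
  = φ (F X □ F Y) (F Z)
      ∘ TT ((pp (F X) (F Y) ⊗' idm (T Z)) ∘ ((u X ⊗' u Y) ⊗' u Z)).
Proof.
rewrite associated_nu; bracket_left.
rewrite (wb_action_nat (wb_lift X Y) (alg_id (F Z))).
by crw fmap_comp_r; rewrite !tensm_comp_r wb_lift_unit.
Qed.

Lemma associated_nu_lift_r X Y Z :
  (idm (T X) ⊗' ahom (wb_lift Y Z)) ∘ τ X (Y ⊗ Z)
  = φ (F X) (F Y □ F Z)
      ∘ TT ((idm (T X) ⊗' pp (F Y) (F Z)) ∘ (u X ⊗' (u Y ⊗' u Z))).
Proof.
rewrite associated_nu; bracket_left.
rewrite (wb_action_nat (alg_id (F X)) (wb_lift Y Z)).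
by crw fmap_comp_r; rewrite !tensm_comp_r wb_lift_unit.
Qed.

(** For coassociativity both sides become the action on a triple product, preceded by retractions
    and followed by sections; the associator of algebras intertwines them. The counit laws hold
    because the unit constraints are algebra maps. *)
Lemma associated_is_opmonoidal : IsOpmonoidal (associated_opmonoidal B).
Proof.
split=> [X X' Y Y' f g|X Y Z|X|X].
- rewrite !associated_nu.
  have nat (X1 X2 : M) (h : Hom X1 X2) : TT h ∘ m X1 = m X2 ∘ TT (TT h).
    by rewrite mmul_nat.
  have := wb_action_nat (@Build_AlgHom _ _ (F X) (F X') _ (nat _ _ f))
            (@Build_AlgHom _ _ (F Y) (F Y') _ (nat _ _ g)).
  rewrite /= => H; bracket_left; rewrite H; do 2 crw fmap_comp_r.
  by rewrite !tensm_comp_r !meta_nat.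
- rewrite (associated_nu_lift X Y) (associated_nu_lift Y Z).
  rewrite tensm_idl_comp tensm_idr_comp; bracket_left.
  crw associated_nu_lift_l; crw associated_nu_lift_r.
  rewrite !wb_actionE; bracket_left; rewrite wb_sec_assoc.
  crw (ahom_action (fwd (assoc W (F X) (F Y) (F Z)))).
  do 2 crw fmap_comp_r; rewrite !fmap_comp; bracket_left.
  have H := f_equal (fun f => TT f) (wb_ret_assoc (F X) (F Y) (F Z)).
  rewrite !fmap_comp in H; crw H.
  crw (fmap_comp_r T (α (T X) (T Y) (T Z))).
  by rewrite assoc_nat fmap_comp; bracket_left.
- rewrite associated_nu associated_nu0 tensm_idr_comp; bracket_left.
  crw (wb_action_nat wb_unit_lift (alg_id (F X))).
  crw fmap_comp_r; rewrite tensm_comp_r free_lift_unit comp_idl.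
  rewrite wb_actionE; bracket_left; crw wb_sec_lunit.
  rewrite (ahom_action (fwd (lunit W (F X)))); do 2 crw fmap_comp_r.
  rewrite -{1}(comp_idr p0) -{1}(comp_idl (u X)) tensm_comp; bracket_left.
  rewrite (wb_ret_lunit (F X)) lunit_nat fmap_comp; bracket_left.
  by rewrite mmul_etar comp_idl.
- rewrite associated_nu associated_nu0 tensm_idl_comp; bracket_left.
  crw (wb_action_nat (alg_id (F X)) wb_unit_lift).
  crw fmap_comp_r; rewrite tensm_comp_r free_lift_unit comp_idl.
  rewrite wb_actionE; bracket_left; crw wb_sec_runit.
  rewrite (ahom_action (fwd (runit W (F X)))); do 2 crw fmap_comp_r.
  rewrite -{1}(comp_idr p0) -{1}(comp_idl (u X)) tensm_comp; bracket_left.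
  rewrite (wb_ret_runit (F X)) runit_nat fmap_comp; bracket_left.
  by rewrite mmul_etar comp_idl.
Qed.

(** On free algebras [(m ⊗ m) ∘ τ] is [φ], so this is associativity of [φ]. *)
Lemma associated_W5 : W5 (associated_opmonoidal B).
Proof.
move=> X Y.
rewrite (associated_nu_action (F X) (F Y)) !associated_nu fmap_comp.
bracket_left; rewrite wb_action_assoc.
by crw mmul_nat.
Qed.

(* Both sides of W1 and W2 are an algebra map out of a free algebra, and such
   a map [h] satisfies [m ∘ T (h ∘ u) = h]. *)
Lemma free_hom_unit X Z (f : Hom X (T Z)) :
  m Z ∘ TT (m Z ∘ TT f) ∘ TT (u X) = m Z ∘ TT f.
Proof.
have := f_equal (fun f => m Z ∘ TT f) (free_lift_unit (A := F Z) f).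
by rewrite /= !fmap_comp; bracket_left.
Qed.

Lemma associated_W1 : W1 (associated_opmonoidal B).
Proof.
move=> X.
have H : runit V (T X) ∘ (idm (T X) ⊗' τ0) ∘ (idm (T X) ⊗' m K) ∘ τ X (T K)
    = m X ∘ TT (ahom (fwd (runit W (F X))) ∘ pp (F X) R
                  ∘ (u X ⊗' ahom wb_unit_lift)).
  rewrite associated_nu associated_nu0; crw tensm_comp_r.
  rewrite comp_idl.
  have -> : idm (T X) ⊗' (i0 ∘ ahom wb_unit_lift ∘ m K)
    = (idm (T X) ⊗' i0) ∘ (idm (T X) ⊗' ahom wb_unit_lift)
      ∘ (idm (T X) ⊗' m K) by rewrite !tensm_comp_r !comp_idl.
  bracket_left; crw (wb_action_nat (alg_id (F X)) (action_hom (F K))).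
  crw (wb_action_nat (alg_id (F X)) wb_unit_lift).
  do 2 crw fmap_comp_r; do 2 crw tensm_comp_r.
  rewrite -[ahom (alg_id _)]/(idm (T X)) -[ahom (action_hom _)]/(m K).
  crw mmul_etal; rewrite !comp_idl comp_idr wb_actionE; bracket_left.
  rewrite (wb_sec_runit (F X)).
  rewrite (ahom_action (fwd (runit W (F X)))).
  by do 2 crw fmap_comp_r.
rewrite [RHS]H -[RHS]free_hom_unit -H !fmap_comp.
by bracket_left.
Qed.

Lemma associated_W2 : W2 (associated_opmonoidal B).
Proof.
move=> X.
have H : lunit V (T X) ∘ (τ0 ⊗' idm (T X)) ∘ (m K ⊗' idm (T X)) ∘ τ (T K) X
    = m X ∘ TT (ahom (fwd (lunit W (F X))) ∘ pp R (F X)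
                  ∘ (ahom wb_unit_lift ⊗' u X)).
  rewrite associated_nu associated_nu0; crw tensm_comp_r.
  rewrite comp_idl.
  have -> : (i0 ∘ ahom wb_unit_lift ∘ m K) ⊗' idm (T X)
    = (i0 ⊗' idm (T X)) ∘ (ahom wb_unit_lift ⊗' idm (T X))
      ∘ (m K ⊗' idm (T X)) by rewrite !tensm_comp_r !comp_idl.
  bracket_left; crw (wb_action_nat (action_hom (F K)) (alg_id (F X))).
  crw (wb_action_nat wb_unit_lift (alg_id (F X))).
  do 2 crw fmap_comp_r; do 2 crw tensm_comp_r.
  rewrite -[ahom (alg_id _)]/(idm (T X)) -[ahom (action_hom _)]/(m K).
  crw mmul_etal; rewrite !comp_idl comp_idr wb_actionE; bracket_left.
  rewrite (wb_sec_lunit (F X)).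
  rewrite (ahom_action (fwd (lunit W (F X)))).
  by do 2 crw fmap_comp_r.
rewrite [RHS]H -[RHS]free_hom_unit -H !fmap_comp.
by bracket_left.
Qed.

(** The common right side of W3 and W4 is the idempotent of the triple product of free algebras,
    restricted along the units. *)
Lemma associated_rhs3 X Y Z :
  (τ X Y ⊗' idm (T Z)) ∘ τ (X ⊗ Y) Z ∘ u ((X ⊗ Y) ⊗ Z)
  = (ii (F X) (F Y) ⊗' idm (T Z)) ∘ ii (F X □ F Y) (F Z)
      ∘ pp (F X □ F Y) (F Z) ∘ (pp (F X) (F Y) ⊗' idm (T Z))
      ∘ ((u X ⊗' u Y) ⊗' u Z).
Proof.
rewrite (associated_nu_lift X Y) tensm_idr_comp; bracket_left.
crw associated_nu_lift_l; crw (eq_sym (meta_nat T _)).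
by bracket_left; crw wb_action_unit.
Qed.

Lemma associated_nu_unit X Y :
  τ X Y ∘ u (X ⊗ Y) = ii (F X) (F Y) ∘ pp (F X) (F Y) ∘ (u X ⊗' u Y).
Proof.
rewrite associated_nu; crw (eq_sym (meta_nat T _)).
by crw wb_action_unit.
Qed.

Lemma associated_nu_unit_mul_r X Y :
  (idm (T X) ⊗' m Y) ∘ τ X (T Y) ∘ u (X ⊗ T Y)
  = ii (F X) (F Y) ∘ pp (F X) (F Y) ∘ (u X ⊗' idm (T Y)).
Proof.
rewrite associated_nu; bracket_left.
rewrite (wb_action_nat (alg_id (F X)) (action_hom (F Y))).
crw fmap_comp_r; rewrite tensm_comp_r mmul_etal comp_idl.
by crw (eq_sym (meta_nat T _)); crw wb_action_unit.
Qed.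

Lemma associated_nu_unit_mul_l X Y :
  (m X ⊗' idm (T Y)) ∘ τ (T X) Y ∘ u (T X ⊗ Y)
  = ii (F X) (F Y) ∘ pp (F X) (F Y) ∘ (idm (T X) ⊗' u Y).
Proof.
rewrite associated_nu; bracket_left.
rewrite (wb_action_nat (action_hom (F X)) (alg_id (F Y))).
crw fmap_comp_r; rewrite tensm_comp_r mmul_etal comp_idl.
by crw (eq_sym (meta_nat T _)); crw wb_action_unit.
Qed.

(** This is the first Frobenius law on free algebras, with the outer section and retraction
    attached. Associativity of the retractions cancels the inverse associator it introduces. *)
Lemma associated_W3 : W3 (associated_opmonoidal B).
Proof.
move=> X Y Z; rewrite associated_rhs3.
do 2 crw (eq_sym (tensm_idr_comp V _ _ _)).
rewrite associated_nu_unit_mul_r.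
crw (eq_sym (tensm_idl_comp V _ _ _)); rewrite associated_nu_unit.
rewrite !tensm_idr_comp !tensm_idl_comp; bracket_left.
crw (eq_sym (assoc_inv_nat V (u X) (idm (T Y)) (idm (T Z)))).
rewrite tensm_id; do 2 crw (tensm_exchange V (u X)).
crw (wb_frob_l (F X) (F Y) (F Z)).
crw tensm_comp_r; rewrite comp_idl comp_idr.
crw (eq_sym (assoc_nat V (u X) (u Y) (u Z))).
crw (eq_sym (wb_ret_assoc (F X) (F Y) (F Z))).
crw (f_equal (@ahom _ _ _ _) (inv_fwd (assoc W (F X) (F Y) (F Z)))).
by rewrite comp_idr.
Qed.

(** Here the second Frobenius law is used, and the associator is cancelled by coassociativity of the
    sections. *)
Lemma associated_W4 : W4 (associated_opmonoidal B).
Proof.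
move=> X Y Z; rewrite associated_rhs3.
do 2 crw (eq_sym (tensm_idl_comp V _ _ _)).
rewrite associated_nu_unit_mul_l.
crw (eq_sym (tensm_idr_comp V _ _ _)); rewrite associated_nu_unit.
rewrite !tensm_idr_comp !tensm_idl_comp; bracket_left.
crw (eq_sym (assoc_nat V (idm (T X)) (idm (T Y)) (u Z))).
rewrite tensm_id; do 2 crw (eq_sym (tensm_exchange V _ (u Z))).
crw (wb_frob_r (F X) (F Y) (F Z)).
crw (eq_sym (wb_sec_assoc (F X) (F Y) (F Z))); rewrite inv_fwd comp_idl.
crw (tensm_comp_r V (idm (T X ⊗ T Y)) (u X ⊗' u Y) (u Z) (idm Z)).
by rewrite comp_idl comp_idr.
Qed.

End FromBimonad.

(** * Uniqueness *)

Section IsoToEq.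

Variables (M : Category) (V : Monoidal M) (T : Monad M).
Variables (B B' : WeakBimonad V T) (w : WeakBimonadIso B B').

Lemma iso_opmonoidal_eq :
  opmonoidal_eq (associated_opmonoidal B) (associated_opmonoidal B').
Proof.
split=> [X Y|] /=.
- rewrite -(wbi_p w) -(wbi_i w) fmap_comp; bracket_left.
  by crw (eq_sym (ahom_action (mu (wbi w) (free_alg T X) (free_alg T Y)))).
- rewrite -(wbi_p0 w) -(wbi_i0 w) fmap_comp; bracket_left.
  by crw (eq_sym (ahom_action (mu0 (wbi w)))).
Qed.

End IsoToEq.

Section EqToIso.

Variables (M : Category) (V : Monoidal M) (T : Monad M).

Local Notation "f ⊗' g" := (tensm V f g) (at level 35, right associativity).
Local Notation "'TT' f" := (fmap T f) (at level 10, f at level 9).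
Local Notation R B := (munit (wb_tens B)).
Local Notation id A := (idm (carrier A)).
Local Notation "f '⊠[' B ] g" :=
  (tensm (wb_tens B) (f : @Hom (EM T) _ _) (g : @Hom (EM T) _ _))
  (at level 35).

Implicit Types (B : WeakBimonad V T) (P Q S : Algebra T).

Lemma wb_sec_mono B P Q X (f g : Hom X (carrier (tens (wb_tens B) P Q))) :
  wb_sec B P Q ∘ f = wb_sec B P Q ∘ g -> f = g.
Proof.
move=> H; rewrite -(comp_idl f) -(comp_idl g) -(wb_ret_sec B P Q).
by rewrite !comp_assoc H.
Qed.

(* An endomorphism of the unit object preserving the counit is the identity:
   it acts trivially under tensoring by the unit constraint. *)
Lemma wb_unit_endo B (f : AlgHom (R B) (R B)) :
  wb_counit B ∘ ahom f = wb_counit B -> f = alg_id (R B).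
Proof.
move=> Hf.
(* The left unit constraint is computed from the counit, which [f] preserves, so composing with it
   hides [f]. *)
have fR : f ⊠[B] alg_id (R B) = alg_id (tens (wb_tens B) (R B) (R B)).
  apply: (@iso_mono (EM T) _ _ (lunit (wb_tens B) (R B))).
  apply: AlgHom_eq; rewrite /= -!wb_sec_lunit comp_idr.
  crw (eq_sym (wb_sec_nat B f (alg_id (R B)))).
  by crw tensm_comp_r; rewrite Hf comp_idl.
apply: (@iso_epi (EM T) _ _ (runit (wb_tens B) (R B))).
rewrite -(runit_nat (wb_tens B) f) -(runit_nat (wb_tens B) (alg_id (R B))).
congr (_ ∘ _); rewrite fR.
exact: (eq_sym (tensm_id (wb_tens B) (R B) (R B))).
Qed.

Section Comparison.

Variables B B' : WeakBimonad V T.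
Hypothesis HB :
  opmonoidal_eq (associated_opmonoidal B) (associated_opmonoidal B').

Local Notation pp := (wb_ret B).
Local Notation ii := (wb_sec B).
Local Notation pp' := (wb_ret B').
Local Notation ii' := (wb_sec B').

(** By [associated_nu_action], [φ] depends only on [τ] and the algebra actions. *)
Lemma wb_action_eq P Q : wb_action B P Q = wb_action B' P Q.
Proof. by rewrite -!associated_nu_action (proj1 HB). Qed.

Lemma wb_idem_eq P Q : ii P Q ∘ pp P Q = ii' P Q ∘ pp' P Q.
Proof. by rewrite -!wb_action_unit wb_action_eq. Qed.

Lemma comparison_action P Q :
  pp' P Q ∘ ii P Q ∘ action (tens (wb_tens B) P Q)
  = action (tens (wb_tens B') P Q) ∘ TT (pp' P Q ∘ ii P Q).
Proof.
have H : ii P Q ∘ action (tens (wb_tens B) P Q) = wb_action B P Q ∘ TT (ii P Q).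
  rewrite wb_actionE; crw fmap_comp_r.
  by rewrite wb_ret_sec fmap_id comp_idr.
crw H; rewrite wb_action_eq wb_actionE; bracket_left.
by rewrite wb_ret_sec comp_idl fmap_comp; bracket_left.
Qed.

Definition comparison P Q :
    AlgHom (tens (wb_tens B) P Q) (tens (wb_tens B') P Q) :=
  @Build_AlgHom _ _ (tens (wb_tens B) P Q) (tens (wb_tens B') P Q) _
    (comparison_action P Q).

Lemma sec_comparison P Q : ii' P Q ∘ ahom (comparison P Q) = ii P Q.
Proof.
by rewrite /=; bracket_left; rewrite -wb_idem_eq comp_assoc wb_ret_sec comp_idr.
Qed.

Lemma comparison_ret P Q : ahom (comparison P Q) ∘ pp P Q = pp' P Q.
Proof.
by rewrite /= comp_assoc wb_idem_eq; bracket_left; rewrite wb_ret_sec comp_idl.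
Qed.

Lemma comparison_nat P P' Q Q' (f : AlgHom P P') (g : AlgHom Q Q') :
  ahom (comparison P' Q') ∘ ahom (f ⊠[B] g)
  = ahom (f ⊠[B'] g) ∘ ahom (comparison P Q).
Proof.
apply: wb_sec_mono; bracket_left.
rewrite sec_comparison -!wb_sec_nat.
by rewrite comp_assoc sec_comparison.
Qed.

Local Notation a P Q S := (ahom (fwd (assoc (wb_tens B) P Q S))).
Local Notation a' P Q S := (ahom (fwd (assoc (wb_tens B') P Q S))).

Lemma comparison_assoc P Q S :
  a' P Q S ∘ ahom (comparison _ S) ∘ ahom (comparison P Q ⊠[B] alg_id S)
  = ahom (comparison P _) ∘ ahom (alg_id P ⊠[B] comparison Q S) ∘ a P Q S.
Proof.
have mono X (f g : Hom X _) :
    (id P ⊗' ii' Q S) ∘ ii' P (tens (wb_tens B') Q S) ∘ f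
    = (id P ⊗' ii' Q S) ∘ ii' P (tens (wb_tens B') Q S) ∘ g -> f = g.
  move=> /(f_equal (comp (id P ⊗' pp' Q S))); bracket_left.
  rewrite tensm_comp_r wb_ret_sec comp_idl tensm_id !comp_idl.
  exact: wb_sec_mono.
apply: mono; bracket_left; rewrite -wb_sec_assoc.
do 2 crw sec_comparison.
crw (eq_sym (wb_sec_nat B (comparison P Q) (alg_id S))).
crw (eq_sym (wb_sec_nat B (alg_id P) (comparison Q S))).
do 2 crw tensm_comp_r; rewrite !sec_comparison !comp_idl.
by rewrite wb_sec_assoc.
Qed.

End Comparison.

Lemma eq_opmonoidal_sym B B' :
  opmonoidal_eq (associated_opmonoidal B) (associated_opmonoidal B') ->
  opmonoidal_eq (associated_opmonoidal B') (associated_opmonoidal B).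
Proof. by move=> [H H0]; split=> [X Y|]; rewrite ?H ?H0. Qed.

Lemma comparisonK B B' HB HB' P Q :
  alg_comp (@comparison B' B HB' P Q) (@comparison B B' HB P Q) = alg_id _.
Proof.
apply/AlgHom_eq/wb_sec_mono.
rewrite -[ahom (alg_comp _ _)]/(ahom _ ∘ ahom _); bracket_left.
by rewrite !sec_comparison comp_idr.
Qed.

Section UnitComparison.

Variables B B' : WeakBimonad V T.
Hypothesis HB :
  opmonoidal_eq (associated_opmonoidal B) (associated_opmonoidal B').

(* The composite [R → R ⊠' R' → R ⊠ R' → R']. *)
Definition unit_comparison : AlgHom (R B) (R B') :=
  alg_comp (fwd (lunit (wb_tens B) (R B')))
    (alg_comp (comparison (eq_opmonoidal_sym HB) (R B) (R B'))
       (inv (runit (wb_tens B') (R B)))).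

Lemma inv_runitE P :
  ahom (inv (runit (wb_tens B') P))
  = wb_ret B' P (R B') ∘ (id P ⊗' wb_unit B') ∘ inv (runit V (carrier P)).
Proof.
have H := f_equal (@ahom _ _ _ _) (inv_fwd (runit (wb_tens B') P)).
have := f_equal (fun x => ahom (inv (runit (wb_tens B') P)) ∘ x
    ∘ inv (runit V (carrier P))) (wb_ret_runit B' P).
bracket_left; rewrite [ahom _ ∘ ahom _]H comp_idl => ->.
by crw fwd_inv; rewrite comp_idr.
Qed.

Lemma unit_comparisonE :
  ahom unit_comparison
  = ahom (fwd (lunit (wb_tens B) (R B'))) ∘ wb_ret B (R B) (R B')
    ∘ (id (R B) ⊗' wb_unit B') ∘ inv (runit V (carrier (R B))).
Proof.
rewrite -[LHS]/(ahom _ ∘ (ahom _ ∘ ahom _)) inv_runitE; bracket_left.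
by crw comparison_ret.
Qed.

Lemma unit_comparison_unit : ahom unit_comparison ∘ wb_unit B = wb_unit B'.
Proof.
rewrite unit_comparisonE; crw runit_inv_nat.
crw (eq_sym (tensm_exchange V (wb_unit B) (wb_unit B'))).
rewrite wb_ret_lunit lunit_nat lunit_unit.
by crw fwd_inv; rewrite comp_idr.
Qed.

(** The idempotents of [B] and [B'] agree, so [ii ∘ pp] may be read in [B']. Exchanging the two
    counits then leaves the right unit law of [B'], followed by [wb_counit B]. *)
Lemma unit_comparison_counit :
  wb_counit B' ∘ ahom unit_comparison = wb_counit B.
Proof.
rewrite unit_comparisonE -wb_sec_lunit; bracket_left.
rewrite -lunit_nat; crw (wb_idem_eq HB).
crw (eq_sym (tensm_exchange V (wb_counit B) (wb_counit B'))).
rewrite lunit_unit runit_nat; crw (wb_sec_runit B'); crw (wb_ret_runit B').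
by crw fwd_inv; rewrite comp_idr.
Qed.

End UnitComparison.

(** The composite preserves the counit, so [wb_unit_endo] applies. *)
Lemma unit_comparisonK B B' HB HB' :
  alg_comp (@unit_comparison B' B HB') (@unit_comparison B B' HB) = alg_id _.
Proof.
apply: wb_unit_endo; rewrite -[ahom (alg_comp _ _)]/(ahom _ ∘ ahom _).
by bracket_left; rewrite !unit_comparison_counit.
Qed.

Lemma eq_opmonoidal_iso B B' :
  opmonoidal_eq (associated_opmonoidal B) (associated_opmonoidal B') ->
  wb_isomorphic B B'.
Proof.
move=> HB; have HB' := eq_opmonoidal_sym HB.
pose w := @Build_MonoidalData _ _ (wb_tens B') (wb_tens B) (id_functor (EM T))
            (comparison HB) (unit_comparison HB).
constructor; exists w.
- split=> [P P' Q Q' f g|P Q S|P|P]; apply: AlgHom_eq.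
  + exact: comparison_nat.
  + exact: comparison_assoc.
  (* Both unit constraints are expressed through sections and counits, so only compatibility with
     the counit is required. *)
  + rewrite -[LHS]/(ahom (fwd (lunit (wb_tens B') P)) ∘ ahom (comparison HB _ P)
      ∘ ahom (unit_comparison HB ⊠[B] alg_id P)).
    rewrite -[RHS]/(ahom (fwd (lunit (wb_tens B) P))).
    rewrite -!wb_sec_lunit; crw sec_comparison.
    crw (eq_sym (wb_sec_nat B (unit_comparison HB) (alg_id P))).
    by crw tensm_comp_r; rewrite unit_comparison_counit comp_idl.
  + rewrite -[LHS]/(ahom (fwd (runit (wb_tens B') P)) ∘ ahom (comparison HB P _)
      ∘ ahom (alg_id P ⊠[B] unit_comparison HB)).
    rewrite -[RHS]/(ahom (fwd (runit (wb_tens B) P))).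
    rewrite -!wb_sec_runit; crw sec_comparison.
    crw (eq_sym (wb_sec_nat B (alg_id P) (unit_comparison HB))).
    by crw tensm_comp_r; rewrite unit_comparison_counit comp_idl.
- by move=> P Q; exists (comparison HB' P Q); split; apply: comparisonK.
- by exists (unit_comparison HB'); split; apply: unit_comparisonK.
- exact: comparison_ret.
- exact: unit_comparison_unit.
- exact: sec_comparison.
- exact: unit_comparison_counit.
Qed.

End EqToIso.

Theorem theorem1p5 :
  forall (M : Category) (V : Monoidal M) (T : Monad M),
  idempotents_split M ->
  (forall B : WeakBimonad V T,
     IsOpmonoidal (associated_opmonoidal B) /\
     W1 (associated_opmonoidal B) /\ W2 (associated_opmonoidal B) /\
     W3 (associated_opmonoidal B) /\ W4 (associated_opmonoidal B) /\
     W5 (associated_opmonoidal B)) /\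
  (forall t : OpmonoidalData V V T,
     IsOpmonoidal t -> W1 t -> W2 t -> W3 t -> W4 t -> W5 t ->
     exists B : WeakBimonad V T, opmonoidal_eq (associated_opmonoidal B) t) /\
  (forall B B' : WeakBimonad V T,
     wb_isomorphic B B' <->
     opmonoidal_eq (associated_opmonoidal B) (associated_opmonoidal B')).
Proof.
move=> M V T split; split; last split.
- move=> B; split; first exact: associated_is_opmonoidal.
  split; first exact: associated_W1.
  split; first exact: associated_W2.
  split; first exact: associated_W3.
  split; first exact: associated_W4.
  exact: associated_W5.
- move=> t Ht HW1 HW2 HW3 HW4 HW5.
  exists (box_bimonad split Ht HW1 HW2 HW3 HW4 HW5).
  exact: associated_box_bimonad.
- move=> B B'; split; last exact: eq_opmonoidal_iso.
  by case=> w; apply: iso_opmonoidal_eq.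
Qed.
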